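(* Let $\underline{T}=(T_1,\dots,T_k)$ be a tuple of contractions on a Hilbert space $\mathcal{H}$ and $q_{ij}\in\mathbb{T}$ ($1\le i<j\le k$) with $T_iT_j=q_{ij}T_jT_i$ for $i<j$. Then $\underline{T}$ admits a regular $Q$-unitary dilation in each of the following cases: (1) each $T_i$ is an isometry; (2) $\underline{T}$ is doubly $q$-commuting, i.e. additionally $T_iT_j^*=\overline{q_{ij}}\,T_j^*T_i$ for $i<j$; (3) $\|T_1\|^2+\dots+\|T_k\|^2\le1$.
   Context: Set $q_{ji}=q_{ij}^{-1}$. For an integer $m$, $m^+=\max\{m,0\}$, $m^-=-\min\{m,0\}$. The tuple $\underline{T}$ admits a regular $Q$-unitary dilation if there exist a Hilbert space $\mathcal{K}\supseteq\mathcal{H}$, a commuting family $Q=\{Q_{ij}:i\ne j\}$ of unitaries on $\mathcal{K}$ with $Q_{ij}=Q_{ji}^{-1}$, and unitaries $U_1,\dots,U_k$ on $\mathcal{K}$ with $U_iU_j=Q_{ij}U_jU_i$ and $Q_{ij}U_l=U_lQ_{ij}$ for all $i\ne j$ and all $l$, such that for all distinct $\alpha_1,\dots,\alpha_r\in\{1,\dots,k\}$ and all $m_{\alpha_1},\dots,m_{\alpha_r}\in\mathbb{Z}$, \[ \prod_{1\le i<j\le r}q_{\alpha_i\alpha_j}^{-m_{\alpha_i}^+m_{\alpha_j}^-}\big[(T_{\alpha_1}^{m_{\alpha_1}^-})^*\cdots(T_{\alpha_r}^{m_{\alpha_r}^-})^*\big]\big[T_{\alpha_1}^{m_{\alpha_1}^+}\cdots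 T_{\alpha_r}^{m_{\alpha_r}^+}\big]=P_{\mathcal{H}}U_{\alpha_1}^{m_{\alpha_1}}\cdots U_{\alpha_r}^{m_{\alpha_r}}|_{\mathcal{H}}, \] where $P_{\mathcal{H}}$ is the orthogonal projection of $\mathcal{K}$ onto $\mathcal{H}$. *)

(* Defs.v *)
From HB Require Import structures.
From mathcomp Require Import all_boot all_order all_algebra.
From mathcomp Require Import complex.
From mathcomp Require Import boolp classical_sets reals.

Set Implicit Arguments.
Unset Strict Implicit.
Unset Printing Implicit Defensive.

Import Order.TTheory GRing.Theory Num.Theory.
Local Open Scope ring_scope.

Record hilbert (R : realType) := Hilbert {
  hsort :> lmodType R[i];
  hinner : hsort -> hsort -> R[i];
  hinnerDl : forall (a : R[i]) (x y z : hsort),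
      hinner (a *: x + y) z = a * hinner x z + hinner y z;
  hinnerC : forall x y : hsort, hinner y x = conjc (hinner x y);
  hinner_ge0 : forall x : hsort, 0 <= complex.Re (hinner x x);
  hinner_eq0 : forall x : hsort, hinner x x = 0 -> x = 0;
  hcomplete : forall u : nat -> hsort,
      (forall e : R, 0 < e -> exists N : nat, forall m n : nat, (N <= m)%N -> (N <= n)%N ->
          complex.Re (hinner (u m - u n) (u m - u n)) < e) ->
      exists l : hsort, forall e : R, 0 < e -> exists N : nat, forall n : nat, (N <= n)%N ->
          complex.Re (hinner (u n - l) (u n - l)) < e
}.

Section HilbertDefs.
Variable R : realType.

Definition hnorm (H : hilbert R) (x : H) : R := Num.sqrt (complex.Re (hinner x x)).

Definition opnorm (H : hilbert R) (T : H -> H) : R :=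
  sup [set hnorm (T x) | x in [set x : H | hnorm x <= 1]].

Definition contraction (H : hilbert R) (T : H -> H) : Prop :=
  linear T /\ forall x : H, hnorm (T x) <= hnorm x.

Definition is_isometry (H : hilbert R) (T : H -> H) : Prop :=
  forall x y : H, hinner (T x) (T y) = hinner x y.

Definition is_adjoint (H : hilbert R) (T S : H -> H) : Prop :=
  forall x y : H, hinner (T x) y = hinner x (S y).

Definition unitary (H : hilbert R) (U : H -> H) : Prop :=
  [/\ linear U, is_isometry U & exists V : H -> H, cancel U V /\ cancel V U].

End HilbertDefs.

Definition ppart (m : int) : nat := if (0 <= m)%R then `|m|%N else 0%N.
Definition npart (m : int) : nat := if (0 <= m)%R then 0%N else `|m|%N.

(* extension of (q_ij)_{i<j} by q_ji = q_ij^{-1} (and q_ii = 1, never used) *)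
Definition qext (C : fieldType) (k : nat) (q : 'I_k -> 'I_k -> C) (i j : 'I_k) : C :=
  if (i < j)%N then q i j else if (j < i)%N then (q j i)^-1 else 1.

Fixpoint qcoef (C : fieldType) (k : nat) (qx : 'I_k -> 'I_k -> C) (m : 'I_k -> int)
    (s : seq 'I_k) : C :=
  match s with
  | [::] => 1
  | a :: s' => (\prod_(b <- s') ((qx a b)^-1 ^+ (ppart (m a) * npart (m b))%N))
               * qcoef qx m s'
  end.

Definition opprod (V : Type) (k : nat) (T : 'I_k -> V -> V) (p : 'I_k -> nat)
    (s : seq 'I_k) (x : V) : V :=
  foldr (fun a y => iter (p a) (T a) y) x s.

(* T_{a_r}^{p a_r} ... T_{a_1}^{p a_1} applied to x; this is the adjoint of
   adj(T_{a_1}^{p a_1}) ... adj(T_{a_r}^{p a_r}) *)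
Definition opprod_rev (V : Type) (k : nat) (T : 'I_k -> V -> V) (p : 'I_k -> nat)
    (s : seq 'I_k) (x : V) : V :=
  foldl (fun y a => iter (p a) (T a) y) x s.

Definition zpow (V : Type) (U Ui : V -> V) (m : int) : V -> V :=
  if (0 <= m)%R then iter `|m|%N U else iter `|m|%N Ui.

Definition uprod (V : Type) (k : nat) (U Ui : 'I_k -> V -> V) (m : 'I_k -> int)
    (s : seq 'I_k) (x : V) : V :=
  foldr (fun a y => zpow (U a) (Ui a) (m a) y) x s.

(* K ⊇ H is modelled by a linear isometric embedding J : H -> K; then
   P_H X|_H = J^* X J, and an operator identity A = J^* X J on H is written
   in its weak form <A h, h'> = <X (J h), J h'> for all h, h'. The operator
     prod q^{...} [adj(T_{a1}^{m^-}) ... adj(T_{ar}^{m^-})] [T_{a1}^{m^+} ... T_{ar}^{m^+}]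
   has weak form  c * <T_{a1}^{m^+}...T_{ar}^{m^+} h, T_{ar}^{m^-}...T_{a1}^{m^-} h'>. *)
Definition regular_Q_unitary_dilation (R : realType) (H : hilbert R) (k : nat)
    (q : 'I_k -> 'I_k -> R[i]) (T : 'I_k -> H -> H) : Prop :=
  exists (K : hilbert R) (J : H -> K),
  linear J /\ (forall x y : H, hinner (J x) (J y) = hinner x y) /\
  exists (Q : 'I_k -> 'I_k -> K -> K) (U Ui : 'I_k -> K -> K),
    (forall i j, i != j -> unitary (Q i j)) /\
    (forall i j, i != j -> forall x, Q i j (Q j i x) = x) /\
    (forall i j i' j', i != j -> i' != j' -> forall x, Q i j (Q i' j' x) = Q i' j' (Q i j x)) /\
    (forall i, unitary (U i)) /\
    (forall i, cancel (U i) (Ui i) /\ cancel (Ui i) (U i)) /\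
    (forall i j, i != j -> forall x, U i (U j x) = Q i j (U j (U i x))) /\
    (forall i j l, i != j -> forall x, Q i j (U l x) = U l (Q i j x)) /\
    (forall (s : seq 'I_k), uniq s -> forall (m : 'I_k -> int) (h h' : H),
        qcoef (qext q) m s *
          hinner (opprod T (fun a => ppart (m a)) s h)
                 (opprod_rev T (fun a => npart (m a)) s h')
        = hinner (uprod U Ui m s (J h)) (J h')).

(* Main.v *)
Require Import Defs.
From HB Require Import structures.
From mathcomp Require Import all_boot all_order all_algebra.
From mathcomp Require Import complex.
From mathcomp Require Import boolp classical_sets functions reals.
From mathcomp Require Import ring lra zify.
Import Order.TTheory GRing.Theory Num.Theory.
Local Open Scope ring_scope.

(** Brehmer's theorem in twisted form. Put [f_u (x, x) = sum_(v subset u)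
    (-1)^|v| |T_v x|^2]; the sign of these forms does not see the phases q_ij, and
    if they are all nonnegative, then a regular dilation exists.  The dilation space
    is the reproducing kernel Hilbert space of the kernel that prescribes
    <U^m h, U^n g> for m, n in Z^k, namely <(U^p)^* U^m h, (U^p)^* U^n g> with
    p = min(m, n), where (U^p)^* U^m is a scalar multiple of T^(m - p).  This kernel
    is positive because, for x_p the sum of (U^p)^* U^m h_m over m >= p, its
    quadratic form telescopes into sum_p f_{supp p} (x_p, x_p).  The U_i are
    composition operators, so the Q_ij can be taken to be the scalars q_ij.

    The f_u are nonnegative in all three cases.  For isometries f_u = 0 when u is
    nonempty.  If the squared norms sum to at most 1, then
    (1 - sum_(i in u) |T_i|^2) |x|^2 <= f_u (x, x) <= |x|^2 by induction on u.
    If T doubly commutes, then T_i commutes with the positive operator behind f_u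
    for i outside u, hence decreases f_u. *)

Set Implicit Arguments.
Unset Strict Implicit.
Unset Printing Implicit Defensive.

(** * Preliminaries: comparison up to epsilon, semi-inner products, Cauchy-Schwarz *)

Lemma le_of_forall_eps (C : numFieldType) (x y : C) :
  x \is Num.real -> y \is Num.real ->
  (forall e, 0 < e -> x <= y + e) -> x <= y.
Proof.
(* The order of a complex field is partial, so the argument by contradiction needs both sides
   real. *)
move=> xr yr H; rewrite real_leNgt //; apply/negP => yx.
have d0 : 0 < (x - y) / 2 by rewrite divr_gt0 // subr_gt0.
have := H _ d0; rewrite -subr_ge0.
have -> : y + (x - y) / 2 - x = - ((x - y) / 2) by field.
by rewrite oppr_ge0 => /(lt_le_trans d0); rewrite ltxx.
Qed.

(** The hypothesis says that a hermitian 2 x 2 matrix is positive semidefinite, and the conclusion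
    that its determinant is nonnegative. If [r] or [p] is nonzero, the form is evaluated at a vector
    where it equals that entry times the determinant. *)
Lemma psd_CauchySchwarz (C : numClosedFieldType) (p r s : C) :
  (forall a b : C, 0 <= a * a^* * p + a * b^* * s + b * a^* * s^* + b * b^* * r) ->
  `|s| ^+ 2 <= p * r.
Proof.
move=> H.
have p0 : 0 <= p.
  by have := H 1 0; rewrite !conjC0 !conjC1 !(mul0r, mulr0, mul1r, addr0).
have r0 : 0 <= r.
  by have := H 0 1; rewrite !conjC0 !conjC1 !(mul0r, mulr0, mul1r, add0r).
have pJ : p^* = p by apply: conj_Creal; apply: ger0_real.
have rJ : r^* = r by apply: conj_Creal; apply: ger0_real.
rewrite normCK -subr_ge0.
have [rz|rn] := eqVneq r 0; last first.
  have rp : 0 < r by rewrite lt_neqAle eq_sym rn.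
  rewrite -(pmulr_rge0 _ rp); have := H r (- s); rewrite rJ rmorphN /=.
  by congr (0 <= _); ring.
have [pz|pn] := eqVneq p 0; last first.
  have pp : 0 < p by rewrite lt_neqAle eq_sym pn.
  rewrite -(pmulr_rge0 _ pp); have := H (- s^*) p.
  rewrite pJ rmorphN /= conjCK; congr (0 <= _); ring.
(* With both diagonal entries zero the form takes the value -2|s|^2 here. *)
have := H 1 (- s); rewrite rz pz conjC1 rmorphN /=.
rewrite (_ : _ + _ = 2 * (0 * 0 - s * s^*)); last by ring.
by rewrite pmulr_rge0.
Qed.

Section SemiInnerProducts.
Variables (C : numClosedFieldType) (V : lmodType C) (f : V -> V -> C).

Record semi_inner : Prop := SemiInner {
  semi_innerPl : forall a x y z, f (a *: x + y) z = a * f x z + f y z;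
  semi_innerC : forall x y, f y x = (f x y)^*;
  semi_inner_ge0 : forall x, 0 <= f x x }.

Hypothesis fP : semi_inner.

Lemma semi_inner0l z : f 0 z = 0.
Proof.
have := semi_innerPl fP 1 0 0 z; rewrite scaler0 addr0 mul1r => /eqP.
by rewrite -subr_eq0 opprD addrA subrr sub0r oppr_eq0 => /eqP.
Qed.

Lemma semi_innerZl a x z : f (a *: x) z = a * f x z.
Proof. by rewrite -[a *: x]addr0 (semi_innerPl fP) semi_inner0l addr0. Qed.

Lemma semi_innerDl x y z : f (x + y) z = f x z + f y z.
Proof. by rewrite -[x]scale1r (semi_innerPl fP) mul1r scale1r. Qed.

Lemma semi_innerNl x z : f (- x) z = - f x z.
Proof. by rewrite -scaleN1r semi_innerZl mulN1r. Qed.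

Lemma semi_innerZr a x z : f z (a *: x) = a^* * f z x.
Proof. by rewrite (semi_innerC fP) semi_innerZl rmorphM /= -(semi_innerC fP). Qed.

Lemma semi_innerDr x y z : f z (x + y) = f z x + f z y.
Proof. by rewrite (semi_innerC fP) semi_innerDl rmorphD /= -!(semi_innerC fP). Qed.

Lemma semi_innerNr x z : f z (- x) = - f z x.
Proof. by rewrite (semi_innerC fP) semi_innerNl rmorphN /= -(semi_innerC fP). Qed.

Lemma semi_inner_CauchySchwarz x y : `|f x y| ^+ 2 <= f x x * f y y.
Proof.
apply: psd_CauchySchwarz => a b; have := semi_inner_ge0 fP (a *: x + b *: y).
rewrite !semi_innerDl !semi_innerDr !semi_innerZl !semi_innerZr.
rewrite -(semi_innerC fP); congr (0 <= _); ring.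
Qed.

End SemiInnerProducts.

(** * Completeness of the real and complex numbers in epsilon form *)

Section ComplexLimits.
Variable R : realType.
Local Notation C := R[i].

Lemma real_cauchy_cvg (u : nat -> R) :
  (forall e, 0 < e -> exists N, forall m n, (N <= m)%N -> (N <= n)%N -> `|u m - u n| <= e) ->
  exists l, forall e, 0 < e -> exists N, forall n, (N <= n)%N -> `|u n - l| <= e.
Proof.
move=> hu.
(* The limit is the supremum of the eventual lower bounds of the sequence. *)
pose A := [set x | exists N, forall n, (N <= n)%N -> x <= u n]%classic.
have ubA e N : (forall m n, (N <= m)%N -> (N <= n)%N -> `|u m - u n| <= e) ->
    ubound A (u N + e).
  move=> hN x [M hM]; have := hN (maxn M N) N (leq_maxr _ _) (leqnn _).
  have := hM _ (leq_maxl M N); rewrite ler_norml => ? /andP [? ?]; lra.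
have inA e N : (forall m n, (N <= m)%N -> (N <= n)%N -> `|u m - u n| <= e) ->
    A (u N - e).
  move=> hN; exists N => n Nn; have := hN n N Nn (leqnn _).
  by rewrite ler_norml => /andP [? ?]; lra.
have supA : has_sup A.
  have [N hN] := hu 1 ltr01.
  by split; [exists (u N - 1); apply: inA | exists (u N + 1); apply: ubA].
exists (sup A) => e e0; have [N hN] := hu _ (divr_gt0 e0 (ltr0Sn _ 1)).
exists N => n Nn; have := hN n N Nn (leqnn _).
have : sup A <= u N + e / 2.
  by apply: sup_le_ub => //; [case: supA | exact: ubA].
have : u N - e / 2 <= sup A.
  by apply: ub_le_sup; [case: supA | exact: inA].
by rewrite !ler_norml => ? ? /andP [? ?]; apply/andP; split; lra.
Qed.

Lemma invn_small (e : R) : 0 < e ->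
  exists N : nat, forall n, (N <= n)%N -> (n.+1%:R : R)^-1 <= e.
Proof.
move=> e0; exists (Num.bound e^-1) => n Nn.
rewrite -[e]invrK lef_pV2 ?posrE ?invr_gt0 //.
apply: le_trans (ltW (archi_boundP _)) _; first by rewrite invr_ge0 ltW.
by rewrite ler_nat (leq_trans Nn).
Qed.

Lemma normc_ge_Re_Im (z : C) :
  (`|complex.Re z|)%:C%C <= `|z| /\ (`|complex.Im z|)%:C%C <= `|z|.
Proof.
split; first exact: normc_ge_Re.
case: z => a b; rewrite normc_def lecR /= -sqrtr_sqr ler_wsqrtr //.
by rewrite lerDr sqr_ge0.
Qed.

Lemma normc_le_Re_Im (z : C) :
  `|z| <= (`|complex.Re z| + `|complex.Im z|)%:C%C.
Proof.
rewrite [z in `|z|]complexE (le_trans (ler_normD _ _)) // rmorphD /= lerD //.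
  by rewrite normc_def /= expr0n /= addr0 sqrtr_sqr.
rewrite normrM (_ : `|_| = 1) ?mul1r; last first.
  by rewrite normc_def /= expr0n /= add0r expr1n sqrtr1.
by rewrite normc_def /= expr0n /= addr0 sqrtr_sqr.
Qed.

Lemma gt0_complexP (e : C) : 0 < e -> exists2 d : R, 0 < d & e = d%:C%C.
Proof.
by case: e => a b; rewrite ltcE /= => /andP [/eqP -> a0]; exists a.
Qed.

Lemma invn_small_complex (e : C) : 0 < e ->
  exists N : nat, forall n, (N <= n)%N -> (n.+1%:R : C)^-1 <= e.
Proof.
move=> /gt0_complexP [d d0 ->]; have [N hN] := invn_small d0.
exists N => n /hN h; have -> : (n.+1%:R : C)^-1 = (n.+1%:R^-1)%:C%C.
  by rewrite fmorphV rmorph_nat.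
by rewrite lecR.
Qed.

Lemma complex_cauchy_cvg (u : nat -> C) :
  (forall e, 0 < e -> exists N, forall m n, (N <= m)%N -> (N <= n)%N -> `|u m - u n| <= e) ->
  exists l, forall e, 0 < e -> exists N, forall n, (N <= n)%N -> `|u n - l| <= e.
Proof.
move=> hu.
have [e e0|a ha] := @real_cauchy_cvg (fun n => complex.Re (u n)).
  have [|N hN] := hu e%:C%C; first by rewrite ltcR.
  exists N => m n Nm Nn; have := hN m n Nm Nn.
  move/(le_trans (normc_ge_Re_Im _).1); rewrite lecR.
  by case: (u m) (u n) => [? ?] [? ?].
have [e e0|b hb] := @real_cauchy_cvg (fun n => complex.Im (u n)).
  have [|N hN] := hu e%:C%C; first by rewrite ltcR.
  exists N => m n Nm Nn; have := hN m n Nm Nn.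
  move/(le_trans (normc_ge_Re_Im _).2); rewrite lecR.
  by case: (u m) (u n) => [? ?] [? ?].
exists (Complex a b) => e /gt0_complexP [d d0 ->].
have [N hN] := ha _ (divr_gt0 d0 (ltr0Sn _ 1)).
have [M hM] := hb _ (divr_gt0 d0 (ltr0Sn _ 1)).
exists (maxn N M) => n; rewrite geq_max => /andP [Nn Mn].
apply: le_trans (normc_le_Re_Im _) _; rewrite lecR.
have := hN n Nn; have := hM n Mn.
case: (u n) => [x y] /=; lra.
Qed.

End ComplexLimits.

(** * Reproducing kernel Hilbert spaces *)

Section KernelCombinations.
Variables (R : realType) (X : Type).
Local Notation C := R[i].
Local Notation comb := (seq (C * X)).
Implicit Types (phi psi : X -> C^o) (u v w : comb) (a : C).

(** A list [w] is a formal combination of points. By the reproducing property this is the inner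
    product of [phi] with the same combination of kernel functions, conjugate linear in the
    coefficients. *)
Definition pairing phi w : C := \sum_(t <- w) t.1^* * phi t.2.

Definition comb_scale a v : comb := [seq (a * t.1, t.2) | t <- v].

Definition comb_map (f : X -> X) v : comb := [seq (t.1, f t.2) | t <- v].

Lemma pairing_cat phi v w : pairing phi (v ++ w) = pairing phi v + pairing phi w.
Proof. exact: big_cat. Qed.

Lemma pairing_scale phi a w : pairing phi (comb_scale a w) = a^* * pairing phi w.
Proof.
rewrite /pairing big_map mulr_sumr; apply: eq_bigr => t _ /=.
by rewrite rmorphM mulrA.
Qed.

Lemma pairingP phi psi a w :
  pairing (a *: phi + psi) w = a * pairing phi w + pairing psi w.
Proof.
rewrite /pairing mulr_sumr -big_split; apply: eq_bigr => t _ /=.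
by rewrite mulrDr; congr (_ + _); exact: mulrCA.
Qed.

Lemma pairingD phi psi w : pairing (phi + psi) w = pairing phi w + pairing psi w.
Proof. by rewrite -[phi]scale1r pairingP mul1r scale1r. Qed.

Lemma pairingB phi psi w : pairing (phi - psi) w = pairing phi w - pairing psi w.
Proof. by rewrite addrC -scaleN1r pairingP mulN1r addrC. Qed.

Lemma pairing0 w : pairing 0 w = 0.
Proof. by rewrite /pairing big1 // => t _; rewrite mulr0. Qed.

Lemma pairingZ a phi w : pairing (a *: phi) w = a * pairing phi w.
Proof. by rewrite -[a *: phi]addr0 pairingP pairing0 addr0. Qed.

Lemma pairing_map phi f w : pairing phi (comb_map f w) = pairing (phi \o f) w.
Proof. by rewrite /pairing big_map. Qed.

Variable kap : X -> X -> C.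

Definition lincomb v : X -> C^o := fun y => \sum_(t <- v) t.1 * kap t.2 y.

Lemma lincomb_cat v w : lincomb (v ++ w) = lincomb v + lincomb w.
Proof. by apply/funext => y; rewrite /lincomb big_cat. Qed.

Lemma lincomb_scale a v : lincomb (comb_scale a v) = a *: lincomb v.
Proof.
apply/funext => y; rewrite /lincomb big_map [RHS]mulr_sumr.
by apply: eq_bigr => t _ /=; rewrite mulrA.
Qed.

Definition cnorm v : C := sqrtC (pairing (lincomb v) v).

(* [fbounded phi M] says that [phi] has norm at most [M] as a functional on the
   span of the kernel functions; [in_rkhs] is the closure of that span in this norm. *)
Definition fbounded phi (M : C) := forall w, `|pairing phi w| <= M * cnorm w.

Definition in_rkhs phi := forall e : C, 0 < e -> exists v, fbounded (phi - lincomb v) e.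

(** A bound [M] for [phi] and a distance [e] from [psi] to the span control the error of
    [pairing phi w]. Requiring this for all [M], [w], [e] determines the inner product without
    choosing an approximating sequence. The default 0 in [rkhs_inner] is never reached on [in_rkhs],
    by [is_inner_exists]. *)
Definition is_inner phi psi : set C := fun z => forall M w e, 0 <= M -> 0 <= e ->
  fbounded phi M -> fbounded (psi - lincomb w) e -> `|z - pairing phi w| <= M * e.

Definition rkhs_inner phi psi : C := xget 0 (is_inner phi psi).

Definition hermitian_kernel := forall x y, kap y x = (kap x y)^*.

Definition psd_kernel := forall v, 0 <= pairing (lincomb v) v.

Hypothesis kapC : hermitian_kernel.
Hypothesis kap_psd : psd_kernel.

Lemma pairing_lincombC v w : pairing (lincomb w) v = (pairing (lincomb v) w)^*.
Proof.
rewrite /pairing rmorph_sum /=.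
under eq_bigr => t _ do rewrite mulr_sumr.
rewrite exchange_big; apply: eq_bigr => t _ /=.
rewrite rmorphM /= conjCK rmorph_sum mulr_sumr; apply: eq_bigr => s _ /=.
by rewrite rmorphM /= -kapC mulrCA.
Qed.

Lemma cnorm_ge0 v : 0 <= cnorm v.
Proof. by rewrite sqrtC_ge0. Qed.

Lemma cnormK v : cnorm v ^+ 2 = pairing (lincomb v) v.
Proof. exact: sqrtCK. Qed.

Lemma kernel_CauchySchwarz v w : `|pairing (lincomb v) w| <= cnorm v * cnorm w.
Proof.
rewrite -(@ler_pXn2r _ 2) ?nnegrE ?mulr_ge0 ?cnorm_ge0 // exprMn !cnormK.
apply: psd_CauchySchwarz => a b.
have := kap_psd (comb_scale a v ++ comb_scale b w).
rewrite lincomb_cat !lincomb_scale pairing_cat !pairing_scale.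
rewrite !pairingP !pairingZ -pairing_lincombC; congr (0 <= _); ring.
Qed.

Lemma fbounded_lincomb v : fbounded (lincomb v) (cnorm v).
Proof. exact: kernel_CauchySchwarz. Qed.

Lemma cnorm_le v e : 0 <= e -> fbounded (lincomb v) e -> cnorm v <= e.
Proof.
move=> e0 /(_ v); rewrite -cnormK normrX ger0_norm ?cnorm_ge0 // expr2.
have [->|n0] := eqVneq (cnorm v) 0; first by [].
by rewrite ler_pM2r // lt_neqAle eq_sym n0 cnorm_ge0.
Qed.

Lemma fboundedP phi psi a M N : fbounded phi M -> fbounded psi N ->
  fbounded (a *: phi + psi) (`|a| * M + N).
Proof.
move=> hM hN w; rewrite pairingP (le_trans (ler_normD _ _)) // mulrDl.
by rewrite lerD // normrM -mulrA ler_wpM2l.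
Qed.

Lemma fboundedD phi psi M N : fbounded phi M -> fbounded psi N ->
  fbounded (phi + psi) (M + N).
Proof.
by move=> hM hN; have := fboundedP 1 hM hN; rewrite scale1r normr1 mul1r.
Qed.

Lemma fboundedB phi psi M N : fbounded phi M -> fbounded psi N ->
  fbounded (phi - psi) (M + N).
Proof.
move=> hM hN; rewrite addrC -scaleN1r [M + N]addrC.
by have := fboundedP (-1) hN hM; rewrite normrN1 mul1r.
Qed.

Lemma fboundedW phi M N : M <= N -> fbounded phi M -> fbounded phi N.
Proof. by move=> MN hM w; rewrite (le_trans (hM w)) // ler_wpM2r ?cnorm_ge0. Qed.

Lemma fbounded0 : fbounded 0 0.
Proof. by move=> w; rewrite mul0r pairing0 normr0. Qed.

Lemma lincombB v w : lincomb (v ++ comb_scale (-1) w) = lincomb v - lincomb w.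
Proof. by rewrite lincomb_cat lincomb_scale scaleN1r. Qed.

Lemma in_rkhs_lincomb v : in_rkhs (lincomb v).
Proof. by move=> e e0; exists v; rewrite subrr; apply: fboundedW fbounded0; apply: ltW. Qed.

Lemma in_rkhsP a phi psi : in_rkhs phi -> in_rkhs psi -> in_rkhs (a *: phi + psi).
Proof.
move=> hphi hpsi e e0.
have a0 : 0 < `|a| + 1 by rewrite ltr_wpDl.
have [v hv] := hphi (e / (`|a| + 1) / 2) ltac:(by rewrite !divr_gt0).
have [w hw] := hpsi (e / 2) ltac:(by rewrite divr_gt0).
exists (comb_scale a v ++ w); rewrite lincomb_cat lincomb_scale.
rewrite opprD addrACA -scalerBr.
apply: fboundedW (fboundedP _ hv hw).
rewrite [leRHS](splitr e) lerD2r !mulrA ler_pM2r ?invr_gt0 //.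
by rewrite ler_pdivrMr // mulrC ler_pM2l // lerDl.
Qed.

Lemma in_rkhs_fbounded phi : in_rkhs phi -> exists2 M, 0 <= M & fbounded phi M.
Proof.
move=> /(_ 1 ltr01) [v hv]; exists (1 + cnorm v).
  by rewrite addr_ge0 ?cnorm_ge0.
by rewrite -[phi](subrK (lincomb v)); apply: fboundedD hv (fbounded_lincomb v).
Qed.

Lemma cnormB_le psi v w d e : 0 <= d -> 0 <= e -> fbounded (psi - lincomb v) d ->
  fbounded (psi - lincomb w) e -> cnorm (v ++ comb_scale (-1) w) <= d + e.
Proof.
move=> d0 e0 hd he; apply: cnorm_le; first exact: addr_ge0.
rewrite lincombB (_ : _ - _ = (psi - lincomb w) - (psi - lincomb v)).
  by rewrite [d + e]addrC; apply: fboundedB.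
by rewrite opprB [RHS]addrC addrA subrK.
Qed.

Lemma pairing_near phi psi v w M d e : 0 <= M -> 0 <= d -> 0 <= e -> fbounded phi M ->
  fbounded (psi - lincomb v) d -> fbounded (psi - lincomb w) e ->
  `|pairing phi v - pairing phi w| <= M * (d + e).
Proof.
move=> M0 d0 e0 hM hd he.
have -> : pairing phi v - pairing phi w = pairing phi (v ++ comb_scale (-1) w).
  by rewrite pairing_cat pairing_scale rmorphN rmorph1 mulN1r.
by rewrite (le_trans (hM _)) // ler_wpM2l //; apply: cnormB_le he.
Qed.

(** The pairings with approximants within 1/(n+1) of [psi] form a Cauchy sequence, and
    [pairing_near] compares its limit with the pairing of any other approximant. *)
Lemma is_inner_exists phi psi : in_rkhs phi -> in_rkhs psi -> exists z, is_inner phi psi z.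
Proof.
move=> /in_rkhs_fbounded [M0 M00 hM0] hpsi.
have eps0 n : 0 < (n.+1%:R : C)^-1 by rewrite invr_gt0.
have [w hw] := choice (fun n => hpsi _ (eps0 n)).
have [e e0|z hz] := @complex_cauchy_cvg R (fun n => pairing phi (w n)).
  (* Adding 1 keeps the divisor positive when the bound is 0; later estimates do the same. *)
  have M1 : 0 < M0 + 1 by rewrite ltr_wpDl.
  have d0 : 0 < e / (M0 + 1) / 2 by rewrite !divr_gt0.
  have [N hN] := invn_small_complex d0.
  exists N => m n Nm Nn.
  have le0 l := ltW (eps0 l).
  apply: le_trans (pairing_near M00 (le0 m) (le0 n) hM0 (hw m) (hw n)) _.
  have -> : e = (M0 + 1) * (e / (M0 + 1) / 2 + e / (M0 + 1) / 2).
    by field; rewrite gt_eqF.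
  by rewrite ler_pM ?addr_ge0 ?(ltW (eps0 _)) ?lerDl ?lerD ?hN.
exists z => M v e M_ge0 e_ge0 hM hv.
apply: le_of_forall_eps; rewrite ?normr_real ?ger0_real ?mulr_ge0 // => d d0.
have M1 : 0 < M + 1 by rewrite ltr_wpDl.
have [N1 hN1] := hz (d / 2) ltac:(by rewrite divr_gt0).
have d1 : 0 < d / (M + 1) / 2 by rewrite !divr_gt0.
have [N2 hN2] := invn_small_complex d1.
have := hN1 _ (leq_maxl N1 N2); have := hN2 _ (leq_maxr N1 N2).
set n := maxn N1 N2 => h2 h1.
rewrite -[z](subrK (pairing phi (w n))) -addrA (le_trans (ler_normD _ _)) //.
rewrite [leRHS](_ : _ = d / 2 + (M * e + d / 2)); last by field.
apply: lerD; first by rewrite distrC.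
apply: le_trans (pairing_near M_ge0 (ltW (eps0 n)) e_ge0 hM (hw n) hv) _.
rewrite mulrDr addrC lerD2l (le_trans (ler_wpM2l M_ge0 h2)) //.
rewrite mulrA ler_pM2r ?invr_gt0 // mulrA ler_pdivrMr // mulrC ler_pM2l //.
by rewrite lerDl.
Qed.

Lemma rkhs_innerP phi psi : in_rkhs phi -> in_rkhs psi ->
  is_inner phi psi (rkhs_inner phi psi).
Proof.
by move=> hphi hpsi; have [z hz] := is_inner_exists hphi hpsi; apply: xgetI hz.
Qed.

(** It is enough to test a candidate value against a single constant [M]. Linearity, symmetry and
    invariance of the inner product are obtained by this criterion. *)
Lemma rkhs_inner_unique phi psi z M : 0 <= M -> in_rkhs phi -> in_rkhs psi ->
  (forall w e, 0 <= e -> fbounded (psi - lincomb w) e -> `|z - pairing phi w| <= M * e) ->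
  rkhs_inner phi psi = z.
Proof.
move=> M0 hphi hpsi hz; have [N N0 hN] := in_rkhs_fbounded hphi.
have M1 : 0 < M + N + 1 by rewrite ltr_wpDl ?addr_ge0.
apply/eqP; rewrite -subr_eq0 -normr_le0.
apply: le_of_forall_eps; rewrite ?normr_real ?real0 // => e e0.
have e1 : 0 < e / (M + N + 1) by rewrite divr_gt0.
have [w hw] := hpsi _ e1.
have := lerD (rkhs_innerP hphi hpsi N0 (ltW e1) hN hw) (hz _ _ (ltW e1) hw).
rewrite [X in _ + X <= _]distrC => /(le_trans (ler_normD _ _)).
rewrite addrA subrK add0r => /le_trans; apply.
rewrite -mulrDl mulrA ler_pdivrMr // mulrC ler_pM2l //.
by rewrite [N + M]addrC lerDl.
Qed.

Lemma rkhs_innerPl a phi psi chi : in_rkhs phi -> in_rkhs psi -> in_rkhs chi ->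
  rkhs_inner (a *: phi + psi) chi = a * rkhs_inner phi chi + rkhs_inner psi chi.
Proof.
move=> hphi hpsi hchi.
have [M M0 hM] := in_rkhs_fbounded hphi; have [N N0 hN] := in_rkhs_fbounded hpsi.
apply: (@rkhs_inner_unique _ _ _ (`|a| * M + N)) => //; first by rewrite addr_ge0 ?mulr_ge0.
  exact: in_rkhsP.
move=> w e e0 hw; rewrite pairingP.
have -> : a * rkhs_inner phi chi + rkhs_inner psi chi - (a * pairing phi w + pairing psi w)
  = a * (rkhs_inner phi chi - pairing phi w) + (rkhs_inner psi chi - pairing psi w) by ring.
rewrite (le_trans (ler_normD _ _)) // mulrDl lerD //; last first.
  exact: (rkhs_innerP hpsi hchi).
by rewrite normrM -mulrA ler_wpM2l // (rkhs_innerP hphi hchi).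
Qed.

Lemma rkhs_inner_lincomb phi w : in_rkhs phi -> rkhs_inner phi (lincomb w) = pairing phi w.
Proof.
move=> hphi; have [M M0 hM] := in_rkhs_fbounded hphi.
apply/eqP; rewrite -subr_eq0 -normr_le0 -(mulr0 M).
apply: rkhs_innerP => //; first exact: in_rkhs_lincomb.
by rewrite subrr; apply: fbounded0.
Qed.

Lemma cnorm_near psi w N d : 0 <= N -> 0 <= d -> fbounded psi N ->
  fbounded (psi - lincomb w) d -> cnorm w <= N + d.
Proof.
move=> N0 d0 hN hw; apply: cnorm_le; first exact: addr_ge0.
have -> : lincomb w = psi - (psi - lincomb w) by rewrite opprB addrC subrK.
exact: fboundedB.
Qed.

Lemma rkhs_innerC phi psi : in_rkhs phi -> in_rkhs psi ->
  rkhs_inner psi phi = (rkhs_inner phi psi)^*.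
Proof.
move=> hphi hpsi.
have [M M0 hM] := in_rkhs_fbounded hphi; have [N N0 hN] := in_rkhs_fbounded hpsi.
apply: (@rkhs_inner_unique _ _ _ N) => // v e e0 hv.
apply: le_of_forall_eps; rewrite ?normr_real ?ger0_real ?mulr_ge0 // => d d0.
(* The total error will be [N * e] plus [d / b] times [M + e + cnorm v]. *)
set b := M + e + cnorm v + 1.
have b0 : 0 < b by rewrite ltr_wpDl ?addr_ge0 ?cnorm_ge0.
have c0 : 0 < d / b by rewrite divr_gt0.
have [w hw] := hpsi _ c0.
have h1 := rkhs_innerP hphi hpsi M0 (ltW c0) hM hw.
have := hv w; rewrite pairingB => h2; have := hw v; rewrite pairingB => h3.
have -> : (rkhs_inner phi psi)^* - pairing psi v =
  (rkhs_inner phi psi - pairing phi w)^* + (pairing phi w - pairing (lincomb v) w)^*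
  - (pairing psi v - pairing (lincomb w) v).
  by rewrite !rmorphB /= -(pairing_lincombC v w); ring.
rewrite (le_trans (ler_normB _ _)) //.
rewrite (le_trans (lerD (ler_normD _ _) (lexx _))) // !norm_conjC.
apply: le_trans (lerD (lerD h1 h2) h3) _.
have h4 := ler_wpM2l e0 (cnorm_near N0 (ltW c0) hN hw).
apply: le_trans (lerD (lerD (lexx _) h4) (lexx _)) _.
rewrite (_ : _ + _ = N * e + d / b * (M + e + cnorm v)); last by ring.
rewrite lerD2l mulrAC ler_pdivrMr // ler_pM2l //.
by rewrite lerDl.
Qed.

Lemma rkhs_inner_ge0 phi : in_rkhs phi -> 0 <= rkhs_inner phi phi.
Proof.
move=> hphi; have [M M0 hM] := in_rkhs_fbounded hphi.
have Nr : rkhs_inner phi phi \is Num.real.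
  by rewrite CrealE -rkhs_innerC.
rewrite -oppr_le0; apply: le_of_forall_eps; rewrite ?rpredN ?real0 // => e e0.
rewrite add0r.
have b0 : 0 < M + M + 1 by rewrite ltr_wpDl ?addr_ge0.
(* The inner product differs from the nonnegative value at an approximant by at most
   [M * d + d * (M + d)], which is at most [d * (M + M + 1)] since [d <= 1]. *)
have [d d0 [d1 d2]] : exists2 d : C, 0 < d & d <= 1 /\ d * (M + M + 1) <= e.
  exists (e / (M + M + 1 + e)).
    by rewrite divr_gt0 // addr_gt0.
  have h : 0 < M + M + 1 + e by rewrite addr_gt0.
  split; first by rewrite ler_pdivrMr // mul1r lerDr ltW.
  by rewrite mulrAC ler_pdivrMr // ler_pM2l // lerDl ltW.
have [v hv] := hphi _ d0.
have h1 := rkhs_innerP hphi hphi M0 (ltW d0) hM hv.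
have := hv v; rewrite pairingB => h2.
have h3 := ler_wpM2l (ltW d0) (cnorm_near M0 (ltW d0) hM hv).
have : `|pairing (lincomb v) v - rkhs_inner phi phi| <= e.
  rewrite -normrN opprB -[rkhs_inner _ _](subrK (pairing phi v)) -addrA.
  rewrite (le_trans (ler_normD _ _)) // (le_trans (lerD h1 (le_trans h2 h3))) //.
  apply: le_trans d2; rewrite [M * d]mulrC -mulrDr ler_pM2l // addrA lerD2l //.
apply: le_trans; rewrite -[leLHS]add0r (le_trans (lerD (kap_psd v) (lexx _))) //.
by rewrite real_ler_norm // rpredD ?rpredN // ger0_real.
Qed.

Lemma rkhs_inner_le phi M : 0 <= M -> in_rkhs phi -> fbounded phi M ->
  rkhs_inner phi phi <= M ^+ 2.
Proof.
move=> M0 hphi hM.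
have N0 := rkhs_inner_ge0 hphi.
apply: le_of_forall_eps; rewrite ?ger0_real ?exprn_ge0 // => e e0.
have b0 : 0 < M + M + 1 by rewrite ltr_wpDl ?addr_ge0.
have c0 : 0 < e / (M + M + 1) by rewrite divr_gt0.
have [v hv] := hphi _ c0.
have h1 := rkhs_innerP hphi hphi M0 (ltW c0) hM hv.
have h2 := le_trans (hM v) (ler_wpM2l M0 (cnorm_near M0 (ltW c0) hM hv)).
rewrite -(ger0_norm N0) -[rkhs_inner _ _](subrK (pairing phi v)).
rewrite (le_trans (ler_normD _ _)) // (le_trans (lerD h1 h2)) //.
rewrite mulrDr addrCA -expr2 lerD2l -mulrDl mulrA ler_pdivrMr // mulrC ler_pM2l //.
by rewrite lerDl.
Qed.

End KernelCombinations.

(** * Symmetries of a kernel and the composition operators they induce *)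

Section KernelSymmetry.
Variables (R : realType) (X : Type) (kap : X -> X -> R[i]) (f g : X -> X).
Hypotheses (fK : cancel f g) (gK : cancel g f).
Hypothesis kap_f : forall x y, kap (f x) (f y) = kap x y.

Lemma kernel_inv_symmetry x y : kap (g x) (g y) = kap x y.
Proof. by rewrite -kap_f !gK. Qed.

Lemma lincomb_map v : lincomb kap (comb_map f v) = lincomb kap v \o g.
Proof.
apply/funext => y; rewrite /lincomb big_map; apply: eq_bigr => t _ /=.
by rewrite -[in LHS](gK y) kap_f.
Qed.

Lemma cnorm_map v : cnorm kap (comb_map f v) = cnorm kap v.
Proof.
rewrite /cnorm lincomb_map pairing_map; congr (sqrtC (pairing _ _)).
by apply/funext => y /=; rewrite fK.
Qed.

End KernelSymmetry.

Section CompositionOperator.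
Variables (R : realType) (X : Type) (kap : X -> X -> R[i]) (f g : X -> X).
Hypotheses (kapC : hermitian_kernel kap) (kap_psd : psd_kernel kap).
Hypotheses (fK : cancel f g) (gK : cancel g f).
Hypothesis kap_f : forall x y, kap (f x) (f y) = kap x y.
Implicit Types phi psi : X -> R[i]^o.

(** Pairing [phi \o g] with [w] is pairing [phi] with the points of [w] moved by [g], which keeps
    [cnorm]. *)
Lemma fbounded_comp phi M : fbounded kap phi M -> fbounded kap (phi \o g) M.
Proof.
move=> hM w; rewrite -pairing_map (le_trans (hM _)) //.
by rewrite (cnorm_map gK fK) //; apply: kernel_inv_symmetry kap_f.
Qed.

Lemma in_rkhs_comp phi : in_rkhs kap phi -> in_rkhs kap (phi \o g).
Proof.
move=> hphi e e0; have [v hv] := hphi e e0; exists (comb_map f v).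
by rewrite (lincomb_map gK kap_f); apply: fbounded_comp hv.
Qed.

End CompositionOperator.

Lemma rkhs_inner_comp (R : realType) (X : Type) (kap : X -> X -> R[i]) (f g : X -> X)
    (phi psi : X -> R[i]^o) :
  hermitian_kernel kap -> psd_kernel kap -> cancel f g -> cancel g f ->
  (forall x y, kap (f x) (f y) = kap x y) -> in_rkhs kap phi -> in_rkhs kap psi ->
  rkhs_inner kap (phi \o g) (psi \o g) = rkhs_inner kap phi psi.
Proof.
move=> kapC kap_psd fK gK kap_f hphi hpsi.
have kap_g := kernel_inv_symmetry gK kap_f.
have [M M0 hM] := in_rkhs_fbounded kapC kap_psd hphi.
apply: (rkhs_inner_unique kapC kap_psd M0); do ?exact: (in_rkhs_comp fK gK kap_f).
move=> w e e0 hw; rewrite -pairing_map.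
apply: rkhs_innerP => //.
rewrite (lincomb_map fK kap_g).
have -> : psi - (lincomb kap w \o f) = ((psi \o g) - lincomb kap w) \o f.
  apply/funext => y; rewrite -[LHS]/(psi y - lincomb kap w (f y)).
  by rewrite -[RHS]/(psi (g (f y)) - lincomb kap w (f y)) fK.
exact: (fbounded_comp gK fK kap_g).
Qed.

(** * The reproducing kernel Hilbert space as a complete space *)

(** The two proofs are bundled with the function so that [rkhs_pred] can be declared a submodule and
    [rkhs] a module. *)
Record kernel (R : realType) (X : Type) := Kernel {
  kerfun :> X -> X -> R[i];
  kerfunC : hermitian_kernel kerfun;
  kerfun_psd : psd_kernel kerfun }.

Section RkhsType.
Variables (R : realType) (X : Type) (kap : kernel R X).
Local Notation C := R[i].

Definition rkhs_pred : {pred (X -> C^o)} := fun phi => `[< in_rkhs kap phi >].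

Lemma rkhs_submod_closed : submod_closed rkhs_pred.
Proof.
have [kapC kap_psd] := (kerfunC kap, kerfun_psd kap).
split=> [|a phi psi /asboolP hphi /asboolP hpsi]; apply/asboolP.
  have -> : 0 = lincomb kap [::] by apply/funext => y; rewrite /lincomb big_nil.
  exact: in_rkhs_lincomb.
exact: in_rkhsP.
Qed.

HB.instance Definition _ :=
  GRing.isSubmodClosed.Build C (X -> C^o) rkhs_pred rkhs_submod_closed.

Record rkhs := Rkhs { rkhs_val : X -> C^o; _ : rkhs_val \in rkhs_pred }.

HB.instance Definition _ := [isSub for rkhs_val].
HB.instance Definition _ := [Choice of rkhs by <:].
HB.instance Definition _ := [SubChoice_isSubLmodule of rkhs by <:].

Lemma rkhsP (x : rkhs) : in_rkhs kap (rkhs_val x).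
Proof. exact/asboolP/(valP x). Qed.

Definition rkhs_dot (x y : rkhs) : C := rkhs_inner kap (rkhs_val x) (rkhs_val y).

Lemma rkhs_valP a (x y : rkhs) :
  rkhs_val (a *: x + y) = a *: rkhs_val x + rkhs_val y.
Proof. by []. Qed.

Lemma rkhs_dotP : semi_inner rkhs_dot.
Proof.
have [kapC kap_psd] := (kerfunC kap, kerfun_psd kap).
split=> [a x y z|x y|x]; rewrite /rkhs_dot.
- by rewrite rkhs_valP rkhs_innerPl //; apply: rkhsP.
- exact: rkhs_innerC (rkhsP x) (rkhsP y).
- exact: rkhs_inner_ge0 (rkhsP x).
Qed.

Definition rkhs_comb (v : seq (C * X)) : rkhs :=
  Rkhs (asboolT (in_rkhs_lincomb (kerfun_psd kap) v)).

Lemma rkhs_dot_comb x v : rkhs_dot x (rkhs_comb v) = pairing (rkhs_val x) v.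
Proof.
by apply: rkhs_inner_lincomb; [exact: kerfunC | exact: kerfun_psd | exact: rkhsP].
Qed.

Lemma fbounded_rkhs_dot x : fbounded kap (rkhs_val x) (sqrtC (rkhs_dot x x)).
Proof.
move=> w; rewrite -rkhs_dot_comb -(@ler_pXn2r _ 2) ?nnegrE //; last first.
  by rewrite mulr_ge0 ?sqrtC_ge0 ?(semi_inner_ge0 rkhs_dotP) ?(kerfun_psd kap).
rewrite exprMn sqrtCK (cnormK kap) -[pairing _ w](rkhs_dot_comb (rkhs_comb w)).
exact: semi_inner_CauchySchwarz rkhs_dotP _ _.
Qed.

Lemma rkhs_dot_le x M : 0 <= M -> fbounded kap (rkhs_val x) M -> rkhs_dot x x <= M ^+ 2.
Proof.
by move=> M0; apply: rkhs_inner_le M0 (rkhsP x); [exact: kerfunC | exact: kerfun_psd].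
Qed.

Lemma rkhs_dot_eq0 x : rkhs_dot x x = 0 -> x = 0.
Proof.
move=> x0; apply: val_inj; apply/funext => t /=; rewrite -[RHS]/(0 : C).
have := fbounded_rkhs_dot x [:: (1, t)].
by rewrite x0 sqrtC0 mul0r normr_le0 /pairing big_seq1 /= rmorph1 mul1r => /eqP.
Qed.

Lemma rkhs_Re_dot x : (complex.Re (rkhs_dot x x))%:C%C = rkhs_dot x x.
Proof. by rewrite RRe_real // ger0_real ?(semi_inner_ge0 rkhs_dotP). Qed.

Lemma rkhs_valB x y : rkhs_val (x - y) = rkhs_val x - rkhs_val y.
Proof. by []. Qed.

(** A norm Cauchy sequence converges pointwise, since evaluations are bounded. A functional bound
    involves finitely many points at a time, so it passes to the pointwise limit, which therefore
    lies in the closure of the span and is the norm limit. *)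
Lemma rkhs_complete (u : nat -> rkhs) :
  (forall e : R, 0 < e -> exists N : nat, forall m n : nat, (N <= m)%N -> (N <= n)%N ->
     complex.Re (rkhs_dot (u m - u n) (u m - u n)) < e) ->
  exists l : rkhs, forall e : R, 0 < e -> exists N : nat, forall n : nat, (N <= n)%N ->
     complex.Re (rkhs_dot (u n - l) (u n - l)) < e.
Proof.
move=> hu; have [kapC kap_psd] := (kerfunC kap, kerfun_psd kap).
have fb (e : C) : 0 < e -> exists N, forall m n, (N <= m)%N -> (N <= n)%N ->
    fbounded kap (rkhs_val (u m) - rkhs_val (u n)) e.
  move=> /gt0_complexP [d d0 ->].
  have [N hN] := hu _ (exprn_gt0 2 d0); exists N => m n Nm Nn.
  rewrite -rkhs_valB; apply: fboundedW (fbounded_rkhs_dot _) => //.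
  rewrite -(@ler_pXn2r _ 2) ?nnegrE ?sqrtC_ge0 ?(semi_inner_ge0 rkhs_dotP) ?ler0c ?ltW //.
  by rewrite sqrtCK -rkhs_Re_dot -rmorphXn /= ltcR hN.
have cvg_at t : exists l : C, forall e, 0 < e -> exists N, forall n, (N <= n)%N ->
    `|rkhs_val (u n) t - l| <= e.
  apply: complex_cauchy_cvg => e e0.
  have c1 : 0 < cnorm kap [:: (1, t)] + 1 by rewrite ltr_wpDl ?cnorm_ge0.
  have [N hN] := fb _ (divr_gt0 e0 c1); exists N => m n Nm Nn.
  have := hN m n Nm Nn [:: (1, t)].
  rewrite {1}/pairing big_seq1 /= rmorph1 mul1r => /le_trans; apply.
  by rewrite mulrAC ler_pdivrMr // ler_pM2l // lerDl.
have [l hl] := choice cvg_at.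
have cvg_pairing w (e : C) : 0 < e -> exists N, forall n, (N <= n)%N ->
    `|pairing (rkhs_val (u n) - l) w| <= e.
  elim: w e => [|[a t] w IH] e e0.
    by exists 0%N => n _; rewrite /pairing big_nil normr0 ltW.
  have a1 : 0 < `|a| + 1 by rewrite ltr_wpDl.
  have [N hN] := hl t _ (divr_gt0 (divr_gt0 e0 a1) (ltr0Sn _ 1)).
  have [M hM] := IH _ (divr_gt0 e0 (ltr0Sn _ 1)).
  exists (maxn N M) => n; rewrite geq_max => /andP [Nn Mn].
  rewrite -cat1s pairing_cat (le_trans (ler_normD _ _)) // [leRHS]splitr.
  rewrite lerD ?hM // /pairing big_seq1 normrM norm_conjC /=.
  apply: le_trans (ler_wpM2l (normr_ge0 _) (hN n Nn)) _.
  by rewrite !mulrA ler_pM2r ?invr_gt0 // ler_pdivrMr // mulrC ler_pM2l // lerDl.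
have fbl (e : C) : 0 < e -> exists N, forall n, (N <= n)%N ->
    fbounded kap (rkhs_val (u n) - l) e.
  move=> e0; have [N hN] := fb e e0; exists N => n Nn w.
  apply: le_of_forall_eps; rewrite ?normr_real ?ger0_real ?mulr_ge0 ?cnorm_ge0 ?ltW //.
  move=> d d0; have [M hM] := cvg_pairing w d d0.
  have := lerD (hN n (maxn N M) Nn (leq_maxl _ _) w) (hM _ (leq_maxr N M)).
  move=> /(le_trans (ler_normD _ _)); rewrite -pairingD.
  by rewrite addrA subrK.
have l_in : in_rkhs kap l.
  move=> e e0; have e2 : 0 < e / 2 by rewrite divr_gt0.
  have [N hN] := fbl _ e2; have [v hv] := rkhsP (u N) e2.
  exists v; have := fboundedB hv (hN N (leqnn N)).
  rewrite -splitr; congr fbounded.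
  by rewrite opprB addrC addrA subrK.
exists (Rkhs (asboolT l_in)) => e e0.
(* Functional bounds are not strict, so [e / 2] is used to get below [e]. *)
have d0 : 0 < Num.sqrt (e / 2) by rewrite sqrtr_gt0 divr_gt0.
have [|N hN] := fbl (Num.sqrt (e / 2))%:C%C; first by rewrite ltcR.
exists N => n Nn; apply: (@le_lt_trans _ _ (e / 2)); last first.
  by rewrite ltr_pdivrMr // ltr_pMr // ltr1n.
rewrite -lecR rkhs_Re_dot -[e / 2]sqr_sqrtr; last by rewrite divr_ge0 // ltW.
by rewrite rmorphXn; apply: rkhs_dot_le; rewrite ?ler0c ?ltW //; apply: hN.
Qed.

Lemma rkhs_dot_Re_ge0 x : 0 <= complex.Re (rkhs_dot x x).
Proof. by rewrite -ler0c rkhs_Re_dot (semi_inner_ge0 rkhs_dotP). Qed.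

Definition feature (x : X) : rkhs := rkhs_comb [:: (1, x)].

Lemma feature_val x y : rkhs_val (feature x) y = kap x y.
Proof. by rewrite /= /lincomb big_seq1 mul1r. Qed.

Lemma rkhs_dot_feature phi x : rkhs_dot phi (feature x) = rkhs_val phi x.
Proof. by rewrite rkhs_dot_comb /pairing big_seq1 /= rmorph1 mul1r. Qed.

Lemma rkhs_ext (phi psi : rkhs) : rkhs_val phi =1 rkhs_val psi -> phi = psi.
Proof. by move=> e; apply: val_inj; apply/funext. Qed.

Section Composition.
Variables f g : X -> X.
Hypotheses (fK : cancel f g) (gK : cancel g f).
Hypothesis kap_f : forall x y, kap (f x) (f y) = kap x y.

Definition rkhs_comp (phi : rkhs) : rkhs :=
  Rkhs (asboolT (in_rkhs_comp fK gK kap_f (rkhsP phi))).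

Lemma rkhs_comp_lin : linear rkhs_comp.
Proof. by move=> a phi psi; apply: rkhs_ext. Qed.

Lemma rkhs_dot_comp phi psi : rkhs_dot (rkhs_comp phi) (rkhs_comp psi) = rkhs_dot phi psi.
Proof.
apply: (rkhs_inner_comp _ _ fK gK kap_f (rkhsP phi) (rkhsP psi)).
  exact: kerfunC.
exact: kerfun_psd.
Qed.

Lemma rkhs_comp_feature x : rkhs_comp (feature x) = feature (f x).
Proof. by apply: rkhs_ext => y; rewrite feature_val -{2}(gK y) kap_f -feature_val. Qed.

End Composition.

Definition rkhs_hilbert : hilbert R :=
  @Hilbert R rkhs rkhs_dot (semi_innerPl rkhs_dotP) (semi_innerC rkhs_dotP)
    rkhs_dot_Re_ge0 rkhs_dot_eq0 rkhs_complete.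

End RkhsType.

(** * Brehmer's forms *)

Section LinearFunctions.
Variables (C : numClosedFieldType) (V : lmodType C) (f : V -> V).
Hypothesis fP : linear f.

Lemma linear_fun0 : f 0 = 0.
Proof.
have := fP (-1) 0 0; rewrite scaler0 addr0 scaleN1r addNr; exact.
Qed.

Lemma linear_funZ a x : f (a *: x) = a *: f x.
Proof. by rewrite -[a *: x]addr0 fP linear_fun0 addr0. Qed.

Lemma linear_funD x y : f (x + y) = f x + f y.
Proof. by rewrite -[x in LHS]scale1r fP scale1r. Qed.

Lemma linear_iter n : linear (iter n f).
Proof. by elim: n => [//|n IH] a x y /=; rewrite IH fP. Qed.

Lemma iter_qcomm (g : V -> V) c n x : (forall y, g (f y) = c *: f (g y)) ->
  g (iter n f x) = c ^+ n *: iter n f (g x).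
Proof.
move=> gf; elim: n => [|n IH] /=; first by rewrite scale1r.
by rewrite gf IH linear_funZ scalerA exprS.
Qed.

End LinearFunctions.

Section BrehmerForms.
Variables (R : realType) (H : hilbert R) (k : nat) (T : 'I_k -> H -> H).
Local Notation C := R[i].

(* [brehmer u x x] is the quadratic form of
   sum_(v subset u) (-1)^|v| (T_v)^* T_v, whose positivity for all u is
   Brehmer's condition. *)
Fixpoint brehmer (s : seq 'I_k) (x y : H) : C :=
  if s is i :: s' then brehmer s' x y - brehmer s' (T i x) (T i y) else hinner x y.

Hypothesis T_lin : forall i, linear (T i).

Lemma brehmerPl s a x y z : brehmer s (a *: x + y) z = a * brehmer s x z + brehmer s y z.
Proof.
elim: s x y z => [|i s IH] x y z /=; first exact: hinnerDl.
by rewrite T_lin !IH; ring.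
Qed.

Lemma brehmerC s x y : brehmer s y x = (brehmer s x y)^*.
Proof.
elim: s x y => [|i s IH] x y /=; first exact: hinnerC.
by rewrite rmorphB /= -!IH.
Qed.

(** The record only bounds the real part of <x, x>; hermitian symmetry makes the imaginary part
    vanish. *)
Lemma hinner_semi_inner : semi_inner (@hinner R H).
Proof.
split=> [a x y z|x y|x]; [exact: hinnerDl | exact: hinnerC | ].
rewrite lecE /= hinner_ge0 andbT.
have := hinnerC x x; case: (hinner x x) => a b /= [] /eqP.
by rewrite -subr_eq0 opprK -mulr2n mulrn_eq0 /= => /eqP ->.
Qed.

Lemma brehmerZl s a x z : brehmer s (a *: x) z = a * brehmer s x z.
Proof.
have br0 y : brehmer s 0 y = 0.
  elim: s y => [|i s IH] y /=; first exact: semi_inner0l hinner_semi_inner y.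
  by rewrite (linear_fun0 (T_lin i)) !IH subrr.
by rewrite -[a *: x]addr0 brehmerPl br0 addr0.
Qed.

Lemma brehmerZr s a x z : brehmer s z (a *: x) = a^* * brehmer s z x.
Proof. by rewrite brehmerC brehmerZl rmorphM /= -brehmerC. Qed.

(** Duplicate-free lists stand for the subsets of the index set. *)
Definition brehmer_positive := forall s x, uniq s -> 0 <= brehmer s x x.

Lemma brehmer_semi_inner s : brehmer_positive -> uniq s -> semi_inner (brehmer s).
Proof.
move=> BP us; split=> [a x y z|x y|x]; [exact: brehmerPl | exact: brehmerC | exact: BP].
Qed.

End BrehmerForms.

(** This is how the phases q_ij drop out of all positivity arguments. *)
Lemma semi_inner_unimodular (C : numClosedFieldType) (V : lmodType C) (f : V -> V -> C) c x y :
  semi_inner f -> `|c| = 1 -> f (c *: x) (c *: y) = f x y.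
Proof.
move=> fP c1; rewrite semi_innerZl // semi_innerZr // mulrA -normCK c1 expr1n.
by rewrite mul1r.
Qed.

(** * Multi-indices in Z^k *)

Section MultiIndices.
Variable k : nat.
Implicit Types (m n p : {ffun 'I_k -> int}) (i j : 'I_k).

Definition mi_unit i : {ffun 'I_k -> int} := [ffun j => (j == i)%:Z].

Definition mi_le m n := forall i, m i <= n i.

Definition mi_min m n : {ffun 'I_k -> int} := [ffun i => Order.min (m i) (n i)].

Lemma mi_minC m n : mi_min m n = mi_min n m.
Proof. by apply/ffunP => i; rewrite !ffunE minC. Qed.

Lemma mi_minid m : mi_min m m = m.
Proof. by apply/ffunP => i; rewrite !ffunE minxx. Qed.

Lemma mi_minl m n : mi_le (mi_min m n) m.
Proof. by move=> i; rewrite ffunE ge_min lexx. Qed.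

Lemma mi_minDr m n p : mi_min (m + p) (n + p) = mi_min m n + p.
Proof. by apply/ffunP => i; rewrite !ffunE addr_minl. Qed.

Lemma mi_le_subr m n : mi_le m n <-> mi_le 0 (n - m).
Proof. by split=> h i; have := h i; rewrite !ffunE subr_ge0. Qed.

Lemma mi_le_sub_unit m i : mi_le (m - mi_unit i) m.
Proof. by move=> j; rewrite !ffunE gerBl. Qed.

(** Induction on the sum of the absolute values, lowering a nonzero entry by one. *)
Lemma mi_ind (P : {ffun 'I_k -> int} -> Prop) :
  P 0 -> (forall m i, mi_le 0 m -> P m -> P (m + mi_unit i)) ->
  forall m, mi_le 0 m -> P m.
Proof.
move=> P0 PS m; move: {2}(\sum_i `|m i|)%N (leqnn (\sum_i `|m i|)%N) => N.
elim: N m => [|N IH] m leN m0.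
  suff -> : m = 0 by [].
  apply/ffunP => i; rewrite ffunE; apply/eqP; rewrite -absz_eq0 -leqn0.
  by apply: leq_trans leN; rewrite (bigD1 i) //= leq_addr.
have [|/existsP [i mi]] := boolP [forall i, m i == 0].
  by move=> /forallP h; suff -> : m = 0 by []; apply/ffunP => i; rewrite ffunE; apply/eqP.
have mi1 : 1 <= m i by have := m0 i; rewrite ffunE; lia.
rewrite -[m](subrK (mi_unit i)); apply: PS; last apply: IH.
- by move=> j; have := m0 j; rewrite !ffunE; case: eqP => [->|_] /=; lia.
- rewrite -ltnS; apply: leq_trans leN; rewrite (bigD1 i) //= [X in (_ < X)%N](bigD1 i) //=.
  rewrite (eq_bigr (fun j => `|m j|%N)) => [|j /negbTE ji]; last by rewrite !ffunE ji subr0.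
  by rewrite ltn_add2r !ffunE eqxx /=; lia.
- by move=> j; have := m0 j; rewrite !ffunE; case: eqP => [->|_] /=; lia.
Qed.

End MultiIndices.

(** * The dilation kernel *)

Section TwistedPowers.
Variables (R : realType) (H : hilbert R) (k : nat) (T : 'I_k -> H -> H).
Local Notation C := R[i].
Variable qx : 'I_k -> 'I_k -> C.
Hypothesis T_lin : forall i, linear (T i).
Hypothesis qx_norm : forall i j, `|qx i j| = 1.
Hypothesis qx_diag : forall i, qx i i = 1.
Hypothesis T_comm : forall i j x, T i (T j x) = qx i j *: T j (T i x).
Local Notation Z := {ffun 'I_k -> int}.
Implicit Types (m n p r : Z) (i j : 'I_k).

Lemma unimodular_neq0 (c : C) : `|c| = 1 -> c != 0.
Proof. by move=> c1; rewrite -normr_eq0 c1 oner_eq0. Qed.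

Let qx_neq0 i j : qx i j != 0.
Proof. exact: unimodular_neq0. Qed.

(* The cocycle of the ordered products: T^m T^n = omega m n T^(m + n). *)
Definition omega m n : C := \prod_(i < k) \prod_(j < k | (j < i)%N) qx i j ^ (m i * n j).

Lemma omegaDl m n p : omega (m + n) p = omega m p * omega n p.
Proof.
rewrite /omega -big_split; apply: eq_bigr => i _; rewrite -big_split.
by apply: eq_bigr => j _; rewrite ffunE mulrDl expfzDr.
Qed.

Lemma omegaDr m n p : omega p (m + n) = omega p m * omega p n.
Proof.
rewrite /omega -big_split; apply: eq_bigr => i _; rewrite -big_split.
by apply: eq_bigr => j _; rewrite ffunE mulrDr expfzDr.
Qed.

Lemma omega_norm m n : `|omega m n| = 1.
Proof.
rewrite /omega normr_prod big1 // => i _; rewrite normr_prod big1 // => j _.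
by case: (_ * _) => a; rewrite /= ?normfV normrX qx_norm expr1n ?invr1.
Qed.

Lemma omega_neq0 m n : omega m n != 0.
Proof. exact/unimodular_neq0/omega_norm. Qed.

Lemma omega0r m : omega m 0 = 1.
Proof. by apply: (mulfI (omega_neq0 m 0)); rewrite -omegaDr addr0 mulr1. Qed.

Lemma omega0l m : omega 0 m = 1.
Proof. by apply: (mulfI (omega_neq0 0 m)); rewrite -omegaDl addr0 mulr1. Qed.

Lemma omegaNr m n : omega m (- n) = (omega m n)^-1.
Proof.
by apply: (mulfI (omega_neq0 m n)); rewrite -omegaDr subrr omega0r mulfV ?omega_neq0.
Qed.

Lemma omega_unitl i n : omega (mi_unit i) n = \prod_(j < k | (j < i)%N) qx i j ^ n j.
Proof.
rewrite /omega (bigD1 i) //= [X in _ * X]big1 ?mulr1 => [|l /negbTE li].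
  by apply: eq_bigr => j _; rewrite ffunE eqxx mul1r.
by apply: big1 => j _; rewrite ffunE li mul0r expr0z.
Qed.

Lemma omega_unit_comm i j :
  (qx i j * qx j i = 1) ->
  omega (mi_unit i) (mi_unit j) = qx i j * omega (mi_unit j) (mi_unit i).
Proof.
have E a b : omega (mi_unit a) (mi_unit b) = if (b < a)%N then qx a b else 1.
  rewrite omega_unitl; case: ifP => ba.
    rewrite (bigD1 b) //= ffunE eqxx expr1z big1 ?mulr1 // => l /andP [_ /negbTE lb].
    by rewrite ffunE lb expr0z.
  apply: big1 => l la; rewrite ffunE; case: eqP => [e|]; last by rewrite expr0z.
  by rewrite e ba in la.
rewrite !E => qq; case: ltngtP => ij; rewrite ?mulr1 //.
by rewrite (val_inj ij) qx_diag.
Qed.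

Lemma opprod_lin (p : 'I_k -> nat) s : linear (opprod T p s).
Proof.
elim: s => [//|i s IH] a x y /=.
by rewrite IH; apply: linear_iter.
Qed.

(** [T i] moves right past the powers of the [T j] with [j < i], which precede its own power in the
    sorted list; each crossing contributes a power of [qx i j]. *)
Lemma opprod_step i (p : 'I_k -> nat) s x : path.sorted (fun a b : 'I_k => a < b)%N s ->
  i \in s ->
  T i (opprod T p s x) = (\prod_(j <- s | (j < i)%N) qx i j ^+ p j) *:
    opprod T (fun j => (p j + (j == i))%N) s x.
Proof.
elim: s => [//|j s IH] s_sorted; rewrite inE.
have tr : transitive (fun a b : 'I_k => a < b)%N by move=> ? ? ?; exact: ltn_trans.
have s_gt := allP (order_path_min tr s_sorted).
have [->|ij] /= := eqVneq i j.
  move=> _; rewrite big_cons ltnn big_seq_cond big_pred0 => [|l]; last first.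
    by apply/andP => - [/s_gt jl lj]; move: (ltn_trans jl lj); rewrite ltnn.
  rewrite scale1r eqxx addn1 iterS; congr (T j (iter _ _ _)).
  elim: {IH s_sorted} s s_gt => [//|l s IH] s_gt /=.
  rewrite IH => [|a la]; last by apply: s_gt; rewrite inE la orbT.
  have jl := s_gt l (mem_head _ _).
  by case: eqP => [lj|_]; [rewrite lj ltnn in jl | rewrite addn0].
move=> is_; have ji := s_gt i is_.
rewrite big_cons ji (iter_qcomm (T_lin j) _ _ (T_comm i j)).
rewrite IH ?(path_sorted s_sorted) //.
by rewrite (linear_funZ (linear_iter (T_lin j) _)) scalerA eq_sym (negbTE ij) addn0.
Qed.

(** The factors stand in increasing order of the index. The absolute value serves as a cast to
    exponents: the product laws assume [mi_le 0 m]. *)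
Definition Tpow m : H -> H := opprod T (fun i => absz (m i)) (enum 'I_k).

Lemma Tpow_lin m : linear (Tpow m).
Proof. exact: opprod_lin. Qed.

Lemma Tpow0 x : Tpow 0 x = x.
Proof. by rewrite /Tpow; elim: (enum _) => //= i s ->; rewrite ffunE. Qed.

Lemma opprod_eq (p p' : 'I_k -> nat) s x : p =1 p' -> opprod T p s x = opprod T p' s x.
Proof. by move=> pp'; elim: s => //= i s ->; rewrite pp'. Qed.

Lemma Tpow_step i m x : mi_le 0 m ->
  T i (Tpow m x) = omega (mi_unit i) m *: Tpow (m + mi_unit i) x.
Proof.
move=> m0; rewrite /Tpow opprod_step ?mem_enum //; last first.
  have := iota_ltn_sorted 0 k; rewrite -val_enum_ord.
  by rewrite sorted_map.
rewrite big_enum_cond omega_unitl; congr (_ *: _); last first.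
  apply: opprod_eq => j; have := m0 j; rewrite !ffunE; case: eqP => _ /=; lia.
by apply: eq_bigr => j _; have := m0 j; rewrite ffunE => /gez0_abs {2}<-.
Qed.

Lemma Tpow_unit i x : Tpow (mi_unit i) x = T i x.
Proof.
have := @Tpow_step i 0 x; rewrite Tpow0 omega0r scale1r add0r => -> //.
Qed.

Lemma TpowD m n x : mi_le 0 m -> mi_le 0 n ->
  Tpow m (Tpow n x) = omega m n *: Tpow (m + n) x.
Proof.
move=> m0 n0; elim/mi_ind: m0 => [|m' i m'0 IH]; first by rewrite Tpow0 omega0l scale1r add0r.
apply: (scalerI (omega_neq0 (mi_unit i) m')).
rewrite -Tpow_step // IH (linear_funZ (T_lin i)) Tpow_step.
  rewrite !scalerA omegaDl omegaDr addrAC; congr (_ *: _); ring.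
by move=> j; have := n0 j; have := m'0 j; rewrite !ffunE; exact: addr_ge0.
Qed.

(* For p <= m, this is (U^p)^* U^m restricted to H, where U is any family of
   isometries extending T with the same commutation relations. *)
Definition descend m p (x : H) : H := omega p (p - m) *: Tpow (m - p) x.

Lemma descend_lin m p : linear (descend m p).
Proof. by move=> a x y; rewrite /descend Tpow_lin scalerDr !scalerA mulrC. Qed.

Lemma descend_id m x : descend m m x = x.
Proof. by rewrite /descend subrr omega0r scale1r Tpow0. Qed.

Lemma descend0 m x : descend m 0 x = Tpow m x.
Proof. by rewrite /descend omega0l scale1r subr0. Qed.

(** The phases match by bilinearity of [omega]: the factor [omega (p - r) (m - p)] from [TpowD]
    cancels one part of [omega p (p - m)]. *)
Lemma descend_comp m p r x : mi_le r p -> mi_le p m ->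
  descend p r (descend m p x) = descend m r x.
Proof.
move=> /mi_le_subr rp /mi_le_subr pm; rewrite /descend (linear_funZ (Tpow_lin _)).
rewrite TpowD // !scalerA (_ : p - r + (m - p) = m - r); last by rewrite addrC addrA subrK.
congr (_ *: _).
have -> : r - m = (r - p) + (p - m) by rewrite addrA subrK.
rewrite [RHS]omegaDr -mulrA; congr (_ * _).
rewrite -(opprB m p) !omegaNr -[p in omega p](subrK r) (omegaDl (p - r) r).
by field; rewrite !omega_neq0.
Qed.

(** The phase depends on [p] and [i] only, so two points brought to the same level acquire the same
    one. *)
Lemma descend_unit m p i x : mi_le p m ->
  descend m (p - mi_unit i) x =
    omega (p - mi_unit i) (- mi_unit i) *: T i (descend m p x).
Proof.
move=> pm; rewrite -(@descend_comp m p) //; last exact: mi_le_sub_unit.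
rewrite {1}/descend (_ : p - (p - mi_unit i) = mi_unit i) ?Tpow_unit.
  by rewrite (_ : p - mi_unit i - p = - mi_unit i) // addrAC subrr add0r.
by rewrite opprB addrC subrK.
Qed.

(* Points (m, h) stand for the vectors U^m h of the dilation space. *)
Local Notation pt := (Z * H)%type.

(** Both vectors descend to their common level before [f] is applied. The inner product gives the
    dilation kernel, and [brehmer T u] the forms met while telescoping. *)
Definition point_form (f : H -> H -> C) (x y : pt) : C :=
  f (descend x.1 (mi_min x.1 y.1) x.2) (descend y.1 (mi_min x.1 y.1) y.2).

(** * Positivity of the dilation kernel *)

Hypothesis BP : brehmer_positive T.

(** On a single level no descent takes place, and the double sum is the form at the sum of the
    vectors. *)
Lemma point_form_diag u m (s : seq pt) : uniq u -> {in s, forall x : pt, x.1 = m} ->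
  0 <= \sum_(x <- s) \sum_(y <- s) point_form (brehmer T u) x y.
Proof.
move=> uu sm; have fP := brehmer_semi_inner T_lin BP uu.
rewrite (_ : \sum_(_ <- _) _ = brehmer T u (\sum_(x <- s) x.2) (\sum_(x <- s) x.2)).
  exact: BP.
have suml (t : seq pt) z : brehmer T u (\sum_(x <- t) x.2) z = \sum_(x <- t) brehmer T u x.2 z.
  elim: t => [|x t IH]; first by rewrite !big_nil (semi_inner0l fP).
  by rewrite !big_cons (semi_innerDl fP) IH.
rewrite suml big_seq [RHS]big_seq; apply: eq_bigr => x xs.
rewrite (semi_innerC fP) suml rmorph_sum /= big_seq [RHS]big_seq.
apply: eq_bigr => y ys.
by rewrite -(semi_innerC fP) /point_form (sm x xs) (sm y ys) mi_minid !descend_id.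
Qed.

Definition push_down i (t : int) (x : pt) : pt :=
  if x.1 i == t then (x.1 - mi_unit i, descend x.1 (x.1 - mi_unit i) x.2) else x.

(** If both points are on the top level, their common level drops too and both vectors acquire [T i]
    up to a common phase; the loss is the form of [i :: u]. If only one is, the minimum does not
    change and [descend_comp] gives equality. *)
Lemma point_form_push u i (t : int) (x y : pt) : uniq u -> x.1 i <= t -> y.1 i <= t ->
  point_form (brehmer T u) x y =
    point_form (brehmer T u) (push_down i t x) (push_down i t y) +
    (if (x.1 i == t) && (y.1 i == t) then point_form (brehmer T (i :: u)) x y else 0).
Proof.
move=> uu xt yt; have fP := brehmer_semi_inner T_lin BP uu.
set p := mi_min x.1 y.1; have px : mi_le p x.1 by exact: mi_minl.
have py : mi_le p y.1 by rewrite /p mi_minC; exact: mi_minl.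
have low (a b : Z) : a i = t -> b i < t -> mi_le (mi_min a b) (a - mi_unit i).
  by move=> ai bi j; rewrite !ffunE; case: eqP => [->|_] /=; lia.
have min_low (a b : Z) : a i = t -> b i < t -> mi_min (a - mi_unit i) b = mi_min a b.
  by move=> ai bi; apply/ffunP => j; rewrite !ffunE; case: eqP => [->|_] /=; lia.
rewrite /push_down; have [xi|xi] := eqVneq (x.1 i) t; have [yi|yi] := eqVneq (y.1 i) t.
- rewrite /= {2}/point_form /= mi_minDr -/p.
  have ps : mi_le (p - mi_unit i) p by exact: mi_le_sub_unit.
  have dn (a : pt) : mi_le p a.1 ->
      descend (a.1 - mi_unit i) (p - mi_unit i) (descend a.1 (a.1 - mi_unit i) a.2) =
      omega (p - mi_unit i) (- mi_unit i) *: T i (descend a.1 p a.2).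
    move=> pa; rewrite descend_comp ?descend_unit //; last exact: mi_le_sub_unit.
    by move=> j; have := pa j; rewrite !ffunE lerD2r.
  rewrite !dn // (semi_inner_unimodular _ _ fP (omega_norm _ _)).
  by rewrite /point_form -/p addrC subrK.
- have yt' : y.1 i < t by rewrite lt_neqAle yi.
  rewrite addr0 /point_form /= min_low // descend_comp //; last exact: mi_le_sub_unit.
  exact: low.
- have xt' : x.1 i < t by rewrite lt_neqAle xi.
  rewrite addr0 /point_form /= mi_minC [mi_min x.1 _]mi_minC min_low // descend_comp //.
    exact: low.
  exact: mi_le_sub_unit.
- by rewrite addr0.
Qed.

(* Induction on the set L of coordinates in which the points differ: pushing
   down the points whose i-th coordinate is maximal, one level at a time, turns
   the form of [u] into a sum of forms of [u] and of [i :: u] at points that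
   agree in the coordinate i as well. *)
Lemma point_form_psd (L u : seq 'I_k) (s : seq pt) : uniq (L ++ u) ->
  {in s &, forall x y : pt, forall i, i \notin L -> x.1 i = y.1 i} ->
  0 <= \sum_(x <- s) \sum_(y <- s) point_form (brehmer T u) x y.
Proof.
elim: L u s => [|i L IH] u s uLu sL.
  case: s sL => [|x s] sL; first by rewrite big_nil.
  apply: (@point_form_diag u x.1) => // y ys.
  by apply/ffunP => i; apply: sL; rewrite ?mem_head.
have uu : uniq u by move: uLu; rewrite cat_uniq => /and3P [].
have uL : uniq (L ++ u) by case/andP: uLu.
have uLi : uniq (L ++ i :: u) by rewrite -cat1s uniq_catCA.
have level (t : int) (s' : seq pt) : {in s', forall x : pt, x.1 i = t} ->
    {in s' &, forall x y : pt, forall j, j \notin i :: L -> x.1 j = y.1 j} ->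
    {in s' &, forall x y : pt, forall j, j \notin L -> x.1 j = y.1 j}.
  move=> st h x y xs ys j jL; have [->|ji] := eqVneq j i; first by rewrite !st.
  by apply: h => //; rewrite inE negb_or ji.
(* Inner induction on the number [d] of levels above [t]: pushing down the top level lowers [d], and
   the correction involves only the top level, on which the coordinate [i] is constant. *)
have range (d : nat) (t : int) (s' : seq pt) :
    {in s', forall x : pt, (t <= x.1 i) && (x.1 i <= t + d%:Z)} ->
    {in s' &, forall x y : pt, forall j, j \notin i :: L -> x.1 j = y.1 j} ->
    0 <= \sum_(x <- s') \sum_(y <- s') point_form (brehmer T u) x y.
  elim: d s' => [|d IHd] s' st s'L.
    by apply: IH => //; apply: (level t) => // x /st; lia.
  have -> : \sum_(x <- s') \sum_(y <- s') point_form (brehmer T u) x y =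
      \sum_(x <- map (push_down i (t + d.+1%:Z)) s')
        \sum_(y <- map (push_down i (t + d.+1%:Z)) s') point_form (brehmer T u) x y +
      \sum_(x <- [seq x : pt <- s' | x.1 i == t + d.+1%:Z])
        \sum_(y <- [seq x : pt <- s' | x.1 i == t + d.+1%:Z])
          point_form (brehmer T (i :: u)) x y.
    rewrite big_map big_filter [X in _ = _ + X]big_mkcond -big_split /=.
    rewrite big_seq [RHS]big_seq; apply: eq_bigr => x xs.
    rewrite big_map big_filter.
    have [xt|xt] := boolP (x.1 i == t + d.+1%:Z).
      rewrite [X in _ = _ + X]big_mkcond -big_split big_seq [RHS]big_seq.
      apply: eq_bigr => y ys /=.
      have [xle yle] : x.1 i <= t + d.+1%:Z /\ y.1 i <= t + d.+1%:Z.
        by split; [case/andP: (st x xs) | case/andP: (st y ys)].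
      by rewrite (point_form_push uu xle yle) xt.
    rewrite addr0 big_seq [RHS]big_seq; apply: eq_bigr => y ys /=.
    have [xle yle] : x.1 i <= t + d.+1%:Z /\ y.1 i <= t + d.+1%:Z.
      by split; [case/andP: (st x xs) | case/andP: (st y ys)].
    by rewrite (point_form_push uu xle yle) (negbTE xt) addr0.
  apply: addr_ge0; last first.
    apply: IH => //; apply: (level (t + d.+1%:Z)).
      by move=> x; rewrite mem_filter => /andP [/eqP].
    by move=> x y; rewrite !mem_filter => /andP [_ xs] /andP [_ ys]; apply: s'L.
  apply: IHd.
    move=> _ /mapP [x /st xt ->]; rewrite /push_down; case: eqP => [xe|] /=; last by lia.
    by rewrite !ffunE eqxx /=; lia.
  have pd (x : pt) j : j \notin i :: L -> (push_down i (t + d.+1%:Z) x).1 j = x.1 j.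
    rewrite inE negb_or /push_down => /andP [/negbTE ji _].
    by case: ifP => //= _; rewrite !ffunE ji subr0.
  by move=> _ _ /mapP [x xs ->] /mapP [y ys ->] j jL; rewrite !pd //; apply: s'L.
have [M hM] : exists M : nat, {in s, forall x : pt, (absz (x.1 i) <= M)%N}.
  exists (\max_(x <- s) absz (x.1 i)) => x xs.
  by rewrite (big_rem x) //= leq_maxl.
apply: (range (M + M)%N (- M%:Z)) => // x /hM; lia.
Qed.

Definition dilation_kernel_fun : pt -> pt -> C := point_form (@hinner R H).

Lemma dilation_kernelC : hermitian_kernel dilation_kernel_fun.
Proof.
by move=> x y; rewrite /dilation_kernel_fun /point_form mi_minC; exact: hinnerC.
Qed.

Lemma dilation_kernel_psd : psd_kernel dilation_kernel_fun.
Proof.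
(* The coefficients are absorbed into the vectors; all coordinates may differ and [u] is empty. *)
move=> v; pose w : seq pt := [seq (t.2.1, t.1 *: t.2.2) | t <- v].
have := @point_form_psd (enum 'I_k) [::] w; rewrite cats0 enum_uniq => /(_ isT).
rewrite (_ : \sum_(_ <- _) _ = pairing (lincomb dilation_kernel_fun v) v); first apply.
  by move=> x y _ _ i; rewrite mem_enum.
have hP := hinner_semi_inner H.
rewrite exchange_big big_map; apply: eq_bigr => t _ /=.
rewrite big_map mulr_sumr; apply: eq_bigr => t' _ /=.
rewrite /dilation_kernel_fun /point_form /= !(linear_funZ (descend_lin _ _)).
by rewrite (semi_innerZl hP) (semi_innerZr hP) mulrCA.
Qed.

Definition dilation_kernel : kernel R pt :=
  Kernel dilation_kernelC dilation_kernel_psd.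

(** * Shifts of the points and the unitaries they induce *)

Definition pscale (c : C) (x : pt) : pt := (x.1, c *: x.2).

(** The point of U_i U^m h, since U_i U^m is [omega (mi_unit i) m] times U^(m + e_i). *)
Definition shift i (x : pt) : pt := (x.1 + mi_unit i, omega (mi_unit i) x.1 *: x.2).

Definition unshift i (x : pt) : pt :=
  (x.1 - mi_unit i, (omega (mi_unit i) (x.1 - mi_unit i))^-1 *: x.2).

Lemma shiftK i : cancel (shift i) (unshift i).
Proof.
by move=> [m h]; rewrite /shift /unshift /= addrK scalerA mulVf ?omega_neq0 ?scale1r.
Qed.

Lemma unshiftK i : cancel (unshift i) (shift i).
Proof.
by move=> [m h]; rewrite /shift /unshift /= subrK scalerA mulfV ?omega_neq0 ?scale1r.
Qed.

Lemma pscaleA a b x : pscale a (pscale b x) = pscale (a * b) x.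
Proof. by rewrite /pscale /= scalerA. Qed.

Lemma pscale1 x : pscale 1 x = x.
Proof. by case: x => m h; rewrite /pscale /= scale1r. Qed.

Lemma shift_pscale i c x : shift i (pscale c x) = pscale c (shift i x).
Proof. by rewrite /shift /pscale /= !scalerA mulrC. Qed.

Hypothesis qx_inv : forall i j, qx i j * qx j i = 1.

Lemma shift_comm i j x : shift i (shift j x) = pscale (qx i j) (shift j (shift i x)).
Proof.
rewrite /shift /pscale /= addrAC !scalerA !omegaDr (omega_unit_comm (qx_inv i j)).
by congr (_, _ *: _); ring.
Qed.

Lemma unshift_comm i j x :
  unshift j (unshift i x) = pscale (qx i j)^-1 (unshift i (unshift j x)).
Proof.
apply: (can_inj (shiftK j)); apply: (can_inj (shiftK i)).
rewrite !unshiftK !shift_pscale shift_comm !unshiftK pscaleA mulVf ?qx_neq0 //.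
by rewrite pscale1.
Qed.

(** The common level [p] moves along with the points, and both descended vectors acquire the same
    phase [omega (mi_unit i) p], which cancels. *)
Lemma dilation_kernel_shift i x y :
  dilation_kernel (shift i x) (shift i y) = dilation_kernel x y.
Proof.
rewrite /= /dilation_kernel_fun /point_form /= mi_minDr.
have E (a : pt) p : descend (a.1 + mi_unit i) (p + mi_unit i) (omega (mi_unit i) a.1 *: a.2) =
    omega (mi_unit i) p *: descend a.1 p a.2.
  rewrite /descend (linear_funZ (Tpow_lin _)) !scalerA opprD addrACA subrr addr0.
  rewrite opprD addrACA subrr addr0; congr (_ *: _).
  rewrite omegaDl -mulrA mulrC; congr (_ * _).
  by rewrite -omegaDr subrK.
by rewrite !E (semi_inner_unimodular _ _ (hinner_semi_inner H) (omega_norm _ _)).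
Qed.

(** * Words in the shifts and the values of the kernel on them *)

Lemma iter_shift_pscale i (n : nat) c x :
  iter n (shift i) (pscale c x) = pscale c (iter n (shift i) x).
Proof. by elim: n => //= n ->; rewrite shift_pscale. Qed.

Lemma iter_shift_comm i j (a b : nat) x : iter b (shift j) (iter a (shift i) x) =
  pscale ((qx i j)^-1 ^+ (a * b)) (iter a (shift i) (iter b (shift j) x)).
Proof.
have qji : qx j i = (qx i j)^-1.
  by rewrite -[RHS]mulr1 -(qx_inv i j) mulrA mulVf ?mul1r.
have one y : shift j (iter a (shift i) y) =
    pscale ((qx i j)^-1 ^+ a) (iter a (shift i) (shift j y)).
  elim: a => [|a IH] /=; first by rewrite pscale1.
  by rewrite shift_comm IH shift_pscale pscaleA qji exprS.
elim: b x => [|b IH] x; first by rewrite muln0 pscale1.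
by rewrite !iterS IH shift_pscale one pscaleA -exprD mulnS addnC.
Qed.

Lemma opprod_rev_pscale (p : 'I_k -> nat) s c x :
  opprod_rev shift p s (pscale c x) = pscale c (opprod_rev shift p s x).
Proof.
elim: s x => [//|j s IH] x.
by rewrite /opprod_rev /= iter_shift_pscale; exact: IH.
Qed.

(** For [n = ppart (m i)] and [p j = npart (m j)] this product is the leading factor of [qcoef] on
    [i :: s]. *)
Lemma opprod_rev_shift_comm i (n : nat) (p : 'I_k -> nat) s x :
  opprod_rev shift p s (iter n (shift i) x) =
  pscale (\prod_(j <- s) (qx i j)^-1 ^+ (n * p j)) (iter n (shift i) (opprod_rev shift p s x)).
Proof.
elim: s x => [|j s IH] x; first by rewrite big_nil pscale1.
have E y : opprod_rev shift p (j :: s) y = opprod_rev shift p s (iter (p j) (shift j) y) by [].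
by rewrite !E iter_shift_comm opprod_rev_pscale IH pscaleA big_cons.
Qed.

Lemma zpow_shift_npart i (z : int) x :
  iter (npart z) (shift i) (zpow (shift i) (unshift i) z x) = iter (ppart z) (shift i) x.
Proof.
rewrite /npart /zpow /ppart; case: ifP => // _.
by elim: `|z|%N x => //= n IH x; rewrite -iterS iterSr unshiftK IH.
Qed.

(* Multiplying by the unitaries that carry the negative exponents turns a word
   in the U_i^(m_i) into a word with nonnegative exponents. *)
Lemma opprod_rev_uprod_shift (m : 'I_k -> int) s x :
  opprod_rev shift (fun i => npart (m i)) s (uprod shift unshift m s x) =
  pscale (qcoef qx m s) (opprod shift (fun i => ppart (m i)) s x).
Proof.
elim: s x => [|i s IH] x; first by rewrite pscale1.
have E y : opprod_rev shift (fun i => npart (m i)) (i :: s) y =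
  opprod_rev shift (fun i => npart (m i)) s (iter (npart (m i)) (shift i) y) by [].
by rewrite E /= zpow_shift_npart opprod_rev_shift_comm IH iter_shift_pscale pscaleA.
Qed.

Lemma dilation_kernel_opprod_rev (p : 'I_k -> nat) s x y :
  dilation_kernel (opprod_rev shift p s x) (opprod_rev shift p s y) = dilation_kernel x y.
Proof.
elim: s x y => [//|i s IH] x y.
have E z : opprod_rev shift p (i :: s) z = opprod_rev shift p s (iter (p i) (shift i) z) by [].
rewrite !E IH; elim: (p i) => // n IHn.
by rewrite !iterS dilation_kernel_shift.
Qed.

(** The support condition on the level is what later makes the levels for the positive and for the
    negative exponents disjoint. The last condition keeps track of all phases. *)
Definition represents (p : 'I_k -> nat) (x : pt) (z : H) :=
  [/\ mi_le 0 x.1, forall i, p i = 0%N -> x.1 i = 0 & Tpow x.1 x.2 = z].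

Lemma represents0 (p : 'I_k -> nat) h : represents p (0, h) h.
Proof. by split=> [i|i _|] /=; rewrite ?ffunE ?Tpow0. Qed.

Lemma represents_iter (p : 'I_k -> nat) x z i : represents p x z ->
  represents p (iter (p i) (shift i) x) (iter (p i) (T i) z).
Proof.
move=> hx; have [->//|pi] := eqVneq (p i) 0%N.
have : forall n : nat, represents p (iter n (shift i) x) (iter n (T i) z); last exact.
elim=> // n [x0 xp xz] /=.
split=> [j|j pj|].
- by have := x0 j; rewrite !ffunE => ?; apply: addr_ge0.
- by rewrite !ffunE xp //; case: eqP => // ji; rewrite -ji pj in pi.
- by rewrite /= (linear_funZ (Tpow_lin _)) -Tpow_step // xz.
Qed.

Lemma represents_opprod (p : 'I_k -> nat) s h :
  represents p (opprod shift p s (0, h)) (opprod T p s h).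
Proof. by elim: s => [|i s IH]; [exact: represents0 | exact: represents_iter]. Qed.

Lemma represents_opprod_rev (p : 'I_k -> nat) s x z : represents p x z ->
  represents p (opprod_rev shift p s x) (opprod_rev T p s z).
Proof. by elim: s x z => [//|i s IH] x z h; apply/IH/represents_iter. Qed.

Lemma dilation_kernel_uprod (m : 'I_k -> int) s (h h' : H) :
  dilation_kernel (uprod shift unshift m s (0, h)) (0, h') =
  qcoef qx m s * hinner (opprod T (fun i => ppart (m i)) s h)
                        (opprod_rev T (fun i => npart (m i)) s h').
Proof.
(* Both arguments are multiplied by the powers that cancel the negative exponents. *)
rewrite -(dilation_kernel_opprod_rev (fun i => npart (m i)) s) opprod_rev_uprod_shift.
have [x0 xp <-] := represents_opprod (fun i => ppart (m i)) s h.
have [y0 yp <-] := represents_opprod_rev s (represents0 (fun i => npart (m i)) h').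
rewrite /= /dilation_kernel_fun /point_form.
set x := opprod _ _ _ _; set y := opprod_rev _ _ _ _.
(* At each index the positive or the negative part of the exponent is 0, so one of the two
   nonnegative levels vanishes there. *)
rewrite (_ : mi_min _ _ = 0) /=; last first.
  apply/ffunP => i; have := x0 i; have := y0 i; rewrite !ffunE => yi xi.
  have [mi|mi] := boolP (0 <= m i).
    by rewrite (yp i) ?/npart ?mi // min_r.
  by rewrite (xp i) ?/ppart ?(negbTE mi) // min_l.
rewrite !descend0 (linear_funZ (Tpow_lin _)).
by rewrite (semi_innerZl (hinner_semi_inner H)).
Qed.

(** * The dilation space, the embedding and the unitaries *)

Local Notation K := (rkhs dilation_kernel).

(** [feature] turns [pscale] into scaling, because the kernel is linear in the vector of its first
    point, and evaluation is the inner product against a feature. *)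
Lemma rkhs_val_pscale (phi : K) c x : rkhs_val phi (pscale c x) = c^* * rkhs_val phi x.
Proof.
rewrite -!rkhs_dot_feature -(semi_innerZr (rkhs_dotP dilation_kernel)); congr (rkhs_dot _ _).
apply: rkhs_ext => y; rewrite feature_val -[RHS]/(c * rkhs_val (feature _ x) y) feature_val.
rewrite /= /dilation_kernel_fun /point_form /= (linear_funZ (descend_lin _ _)).
by rewrite (semi_innerZl (hinner_semi_inner H)).
Qed.

Definition embed (h : H) : K := feature dilation_kernel (0, h).

Lemma embed_lin : linear embed.
Proof.
move=> a x y; apply: rkhs_ext => t.
rewrite -[RHS]/(a * rkhs_val (embed x) t + rkhs_val (embed y) t) !feature_val.
by rewrite /= /dilation_kernel_fun /point_form /= descend_lin hinnerDl.
Qed.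

Lemma rkhs_dot_embed x y : rkhs_dot (embed x) (embed y) = hinner x y.
Proof.
rewrite rkhs_dot_feature feature_val /= /dilation_kernel_fun /point_form /= mi_minid.
by rewrite !descend_id.
Qed.

Definition dil_U i : K -> K := rkhs_comp (shiftK i) (unshiftK i) (dilation_kernel_shift i).

Lemma dilation_kernel_unshift i x y :
  dilation_kernel (unshift i x) (unshift i y) = dilation_kernel x y.
Proof. exact: (kernel_inv_symmetry (unshiftK i) (dilation_kernel_shift i)). Qed.

Definition dil_Ui i : K -> K :=
  rkhs_comp (unshiftK i) (shiftK i) (dilation_kernel_unshift i).

Lemma dil_UK i : cancel (dil_U i) (dil_Ui i).
Proof. by move=> phi; apply: rkhs_ext => t /=; rewrite shiftK. Qed.

Lemma dil_UiK i : cancel (dil_Ui i) (dil_U i).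
Proof. by move=> phi; apply: rkhs_ext => t /=; rewrite unshiftK. Qed.

Lemma dil_U_comm i j phi : dil_U i (dil_U j phi) = qx i j *: dil_U j (dil_U i phi).
Proof.
apply: rkhs_ext => t; rewrite -[RHS]/(qx i j * rkhs_val phi (unshift i (unshift j t))).
rewrite /= unshift_comm rkhs_val_pscale; congr (_ * _).
(* The conjugate of the inverse of a unimodular number is the number itself. *)
have := normCK (qx i j); rewrite qx_norm expr1n => e.
have qJ0 : (qx i j)^* != 0 by rewrite conjC_eq0.
by rewrite fmorphV /=; apply: (mulIf qJ0); rewrite mulVf.
Qed.

Lemma dil_uprod (m : 'I_k -> int) s x :
  uprod dil_U dil_Ui m s (feature dilation_kernel x) =
  feature dilation_kernel (uprod shift unshift m s x).
Proof.
elim: s => [//|i s /= ->]; move: (uprod _ _ _ _ _) => y.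
by rewrite /zpow; case: ifP => _; elim: `|m i|%N => //= n ->; exact: rkhs_comp_feature.
Qed.

End TwistedPowers.

(** * From Brehmer positivity to a regular dilation *)

Section RegularDilation.
Variables (R : realType) (H : hilbert R) (k : nat) (T : 'I_k -> H -> H).
Variable q : 'I_k -> 'I_k -> R[i].
Hypothesis T_lin : forall i, linear (T i).
Hypothesis q_norm : forall i j : 'I_k, (i < j)%N -> `|q i j| = 1.
Hypothesis T_comm : forall i j : 'I_k, (i < j)%N ->
  forall x, T i (T j x) = q i j *: T j (T i x).

Lemma qext_norm i j : `|qext q i j| = 1.
Proof.
rewrite /qext; case: ltngtP => ij; rewrite ?normr1 //; first exact: q_norm.
by rewrite normfV q_norm ?invr1.
Qed.

Lemma qext_diag i : qext q i i = 1.
Proof. by rewrite /qext ltnn. Qed.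

Lemma qext_inv i j : qext q i j * qext q j i = 1.
Proof.
rewrite /qext; case: ltngtP => ij; rewrite ?mulr1 //; [rewrite mulfV // | rewrite mulVf //];
  exact/unimodular_neq0/q_norm.
Qed.

Lemma qext_comm i j x : T i (T j x) = qext q i j *: T j (T i x).
Proof.
rewrite /qext; case: ltngtP => ij; first exact: T_comm.
  by rewrite (T_comm ij) scalerA mulVf ?scale1r //; exact/unimodular_neq0/q_norm.
by rewrite (val_inj ij) scale1r.
Qed.

Lemma brehmer_regular_dilation :
  brehmer_positive T -> regular_Q_unitary_dilation q T.
Proof.
move=> BP.
pose kap := dilation_kernel T_lin qext_norm qext_comm BP.
pose U : 'I_k -> rkhs kap -> rkhs kap := @dil_U _ _ _ _ _ T_lin qext_norm qext_comm BP.
pose Ui : 'I_k -> rkhs kap -> rkhs kap := @dil_Ui _ _ _ _ _ T_lin qext_norm qext_comm BP.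
have dotP := rkhs_dotP kap.
exists (rkhs_hilbert kap), (embed T_lin qext_norm qext_comm BP); split.
  exact: embed_lin.
split; first by move=> x y; exact: rkhs_dot_embed.
exists (fun i j x => qext q i j *: x), U, Ui.
have QK i j (x : rkhs kap) : qext q i j *: (qext q j i *: x) = x.
  by rewrite scalerA qext_inv scale1r.
split; last split; last split; last split; last split; last split; last split.
- move=> i j _; split.
  + by move=> a x y; rewrite scalerDr !scalerA mulrC.
  + by move=> x y; exact: (semi_inner_unimodular _ _ dotP (qext_norm i j)).
  + by exists (fun x => qext q j i *: x); split=> x; exact: QK.
- by move=> i j _ x; exact: QK.
- by move=> i j i' j' _ _ x; rewrite !scalerA mulrC.
- move=> i; split; first exact: rkhs_comp_lin.
    by move=> x y; exact: rkhs_dot_comp.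
  by exists (Ui i); split; [exact: dil_UK | exact: dil_UiK].
- by move=> i; split; [exact: dil_UK | exact: dil_UiK].
- by move=> i j _ x; apply: dil_U_comm; [exact: qext_diag | exact: qext_inv].
- by move=> i j l _ x; rewrite /U /dil_U (linear_funZ (rkhs_comp_lin _ _ _)).
- move=> s _ m h h'.
  rewrite -[RHS]/(rkhs_dot (uprod U Ui m s (feature kap (0, h))) (feature kap (0, h'))).
  rewrite dil_uprod rkhs_dot_feature feature_val.
  by rewrite (dilation_kernel_uprod _ _ qext_diag _ _ qext_inv).
Qed.

End RegularDilation.

(** * Adjoints of contractions *)

Section Adjoint.
Variables (R : realType) (H : hilbert R).
Implicit Types (x y z w : H) (a : R).

(** With the real part, estimates take place in R; imaginary parts are recovered by replacing [x]
    with ['i x]. *)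
Definition rdot x y : R := complex.Re (hinner x y).

Lemma rdotC x y : rdot x y = rdot y x.
Proof. by rewrite /rdot (hinnerC y x); case: (hinner y x). Qed.

Lemma rdotPl a x y z : rdot (a%:C%C *: x + y) z = a * rdot x z + rdot y z.
Proof.
rewrite /rdot hinnerDl; case: (hinner x z) (hinner y z) => [b c] [d e] /=.
by rewrite mul0r subr0.
Qed.

Lemma rdotDl x y z : rdot (x + y) z = rdot x z + rdot y z.
Proof. by have := rdotPl 1 x y z; rewrite scale1r mul1r. Qed.

Lemma rdotZl a x z : rdot (a%:C%C *: x) z = a * rdot x z.
Proof.
have := rdotPl a x 0 z; rewrite addr0 => ->.
by rewrite /(rdot 0 z) (semi_inner0l (hinner_semi_inner H)) addr0.
Qed.

Lemma rdotBl x y z : rdot (x - y) z = rdot x z - rdot y z.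
Proof.
have hP := hinner_semi_inner H.
by rewrite /rdot (semi_innerDl hP) (semi_innerNl hP) raddfB.
Qed.

Lemma rdotDr x y z : rdot z (x + y) = rdot z x + rdot z y.
Proof. by rewrite rdotC rdotDl !(rdotC z). Qed.

Lemma rdotZr a x z : rdot z (a%:C%C *: x) = a * rdot z x.
Proof. by rewrite rdotC rdotZl (rdotC z). Qed.

Lemma rdotBr x y z : rdot z (x - y) = rdot z x - rdot z y.
Proof. by rewrite rdotC rdotBl !(rdotC z). Qed.

Lemma rdot_ge0 x : 0 <= rdot x x.
Proof. exact: hinner_ge0. Qed.

Lemma hinner_rdot x : hinner x x = (rdot x x)%:C%C.
Proof. by rewrite RRe_real // ger0_real // (semi_inner_ge0 (hinner_semi_inner H)). Qed.

Lemma rdot_CauchySchwarz x y : rdot x y ^+ 2 <= rdot x x * rdot y y.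
Proof.
have := semi_inner_CauchySchwarz (hinner_semi_inner H) x y.
rewrite !hinner_rdot -rmorphM -add_Re2_Im2 /= lecR; apply: le_trans.
by rewrite lerDl sqr_ge0.
Qed.

Lemma rdot_eq0 x : rdot x x = 0 -> x = 0.
Proof. by move=> x0; apply: hinner_eq0; rewrite hinner_rdot x0. Qed.

Variable A : H -> H.
Hypothesis A_lin : linear A.
Hypothesis A_contr : forall x, rdot (A x) (A x) <= rdot x x.

Let A_add x y : A (x + y) = A x + A y. Proof. exact: linear_funD. Qed.
Let A_scale (c : R[i]) x : A (c *: x) = c *: A x. Proof. exact: linear_funZ. Qed.

(* The Riesz vector of [x |-> <A x, y>] minimizes [|x|^2 - 2 Re <A x, y>]. *)
Lemma adjoint_vector y : exists z, forall x, hinner (A x) y = hinner x z.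
Proof.
pose g x := rdot x x - 2 * rdot (A x) y.
have g_ge x : - rdot y y <= g x.
  have := A_contr x; have := rdot_ge0 (A x - y).
  rewrite rdotBl !rdotBr (rdotC y (A x)) /g; lra.
have infg : has_inf (range g).
  by split; [exists (g 0), 0 | exists (- rdot y y) => _ [x _ <-]].
set m := inf (range g).
have m_le x : m <= g x by apply: ge_inf; [case: infg | exists x].
have eps0 n : 0 < (n.+1%:R : R)^-1 by rewrite invr_gt0.
have minseq n : exists x, g x < m + n.+1%:R^-1.
  by have [_ [x _ <-] hx] := inf_adherent (eps0 n) infg; exists x.
have [u hu] := choice minseq.
(* Parallelogram law, with [g >= m] at the midpoint; hence minimizing sequences are Cauchy. *)
have para x x' : rdot (x - x') (x - x') <= 2 * (g x - m) + 2 * (g x' - m).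
  have := m_le ((1 / 2)%:C%C *: (x + x')); rewrite /g.
  rewrite A_scale A_add !(rdotBl, rdotBr) !(rdotZl, rdotZr) !(rdotDl, rdotDr).
  rewrite (rdotC x' x); lra.
have [e e0|z hz] := @hcomplete R H u.
  have e5 : 0 < e / 5 by rewrite divr_gt0.
  have [N hN] := invn_small e5.
  exists N => i j Ni Nj; apply: le_lt_trans (para _ _) _.
  have := hu i; have := hu j; have := hN i Ni; have := hN j Nj.
  move: (i.+1%:R^-1) (j.+1%:R^-1) => a b; lra.
(* The derivative of [g] in the direction [w] vanishes at [z]: it is bounded at [u n] and carried
   over to [z] by Cauchy-Schwarz. *)
have re_eq w : rdot w z = rdot (A w) y.
  have [w0|wn0] := eqVneq (rdot w w) 0.
    by rewrite (rdot_eq0 w0) (linear_fun0 A_lin) /rdot !(semi_inner0l (hinner_semi_inner H)).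
  have wp : 0 < rdot w w by rewrite lt_neqAle eq_sym wn0 rdot_ge0.
  set b := rdot w z - rdot (A w) y.
  suff b0 : b ^+ 2 <= 0.
    by apply/eqP; rewrite -subr_eq0 -sqrf_eq0 eq_le b0 sqr_ge0.
  apply: le_of_forall_eps; rewrite ?num_real // => e e0; rewrite add0r.
  have d0 : 0 < e / rdot w w / 4 by rewrite !divr_gt0.
  have [N1 hN1] := invn_small d0; have [N2 hN2] := hz _ d0.
  set n := maxn N1 N2.
  have e1 := hN1 n (leq_maxl _ _); have e2 := hN2 n (leq_maxr _ _).
  rewrite -/(rdot _ _) in e2.
  pose bn := rdot w (u n) - rdot (A w) y.
  have hb : (b - bn) ^+ 2 <= rdot w w * (e / rdot w w / 4).
    have := rdot_CauchySchwarz w (u n - z); rewrite rdotBr.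
    have -> : (b - bn) ^+ 2 = (rdot w (u n) - rdot w z) ^+ 2 by rewrite /b /bn; ring.
    by move=> /le_trans; apply; rewrite ler_pM2l // ltW.
  have hbn : bn ^+ 2 <= rdot w w * (e / rdot w w / 4).
    (* This [t] minimizes [g] on the line through [u n] along [w] and lowers it by
       [bn ^+ 2 / rdot w w], which near-minimality of [u n] makes small. *)
    pose t := - bn / rdot w w.
    have := m_le (u n + t%:C%C *: w); have := hu n.
    move: (n.+1%:R^-1) e1 => eps e1; rewrite /g.
    rewrite A_add A_scale !(rdotDl, rdotDr) !(rdotZl, rdotZr) (rdotC (u n) w) => h1 h2.
    have : bn ^+ 2 / rdot w w <= e / rdot w w / 4.
      have -> : bn ^+ 2 / rdot w w = - (2 * (t * bn) + t * (t * rdot w w)).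
        by rewrite /t; field.
      rewrite mulrBr; lra.
    by rewrite ler_pdivrMr // mulrC.
  have -> : e = 2 * (rdot w w * (e / rdot w w / 4)) + 2 * (rdot w w * (e / rdot w w / 4)).
    by field.
  have : 0 <= (b - bn - bn) ^+ 2 by exact: sqr_ge0.
  have -> : (b - bn - bn) ^+ 2 = 2 * (b - bn) ^+ 2 + 2 * bn ^+ 2 - b ^+ 2 by ring.
  lra.
exists z => x; rewrite [LHS]complexE [RHS]complexE; congr (_%:C%C + _ * _%:C%C).
  by rewrite -!/(rdot _ _) re_eq.
have := re_eq ('i%C *: x); rewrite /rdot A_scale !(semi_innerZl (hinner_semi_inner H)).
by rewrite ![_ * hinner _ _]mulrC !ReiNIm => /eqP; rewrite eqr_opp => /eqP.
Qed.

Lemma adjoint_exists : exists S : H -> H, is_adjoint A S.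
Proof. by have [S hS] := choice adjoint_vector; exists S => x y. Qed.

Variable S : H -> H.
Hypothesis S_adj : is_adjoint A S.

(** From |Sy|^2 = Re <ASy, y>, Cauchy-Schwarz gives |Sy|^4 <= |Sy|^2 |y|^2. *)
Lemma adjoint_contraction y : rdot (S y) (S y) <= rdot y y.
Proof.
have [->|sn0] := eqVneq (rdot (S y) (S y)) 0; first exact: rdot_ge0.
have sp : 0 < rdot (S y) (S y) by rewrite lt_neqAle eq_sym sn0 rdot_ge0.
rewrite -(ler_pM2l sp) -expr2.
have E : rdot (S y) (S y) = rdot (A (S y)) y by rewrite /rdot S_adj.
rewrite {1}E (le_trans (rdot_CauchySchwarz _ _)) //.
by rewrite ler_wpM2r ?rdot_ge0.
Qed.

End Adjoint.

(* Convexity of n |-> f(y_n, y_n), for y = x, A x, S A x, A S A x, ..., makes this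
   sequence nonincreasing once it is bounded. *)
Lemma semi_inner_contraction (R : realType) (V : lmodType R[i]) (f : V -> V -> R[i])
    (A S : V -> V) (N : V -> R) :
  semi_inner f -> (forall x y, f (A x) y = f x (S y)) ->
  (forall x, complex.Re (f x x) <= N x) -> (forall x, N (S (A x)) <= N x) ->
  forall x, f (A x) (A x) <= f x x.
Proof.
move=> fP AS fN NSA.
pose g x := complex.Re (f x x).
have fE x : f x x = (g x)%:C%C by rewrite RRe_real // ger0_real // (semi_inner_ge0 fP).
have f_sub x y : f x y = (complex.Re (f x y))%:C%C ->
    complex.Re (f (x - y) (x - y)) = g x - 2 * complex.Re (f x y) + g y.
  move=> h; rewrite (semi_innerDl fP) !(semi_innerDr fP) !(semi_innerNl fP, semi_innerNr fP).
  rewrite !fE (semi_innerC fP x y) h /=; ring.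
have g_ge0 x : 0 <= g x by rewrite -ler0c -fE (semi_inner_ge0 fP).
(* Convexity comes from nonnegativity of [f] at the difference of terms two places apart. *)
have step1 x : g (A x) - g x <= g (S (A x)) - g (A x).
  have e : f x (S (A x)) = (g (A x))%:C%C by rewrite -AS fE.
  have := g_ge0 (x - S (A x)); rewrite {1}/g f_sub ?e //=; lra.
have step2 x : g (S (A x)) - g (A x) <= g (A (S (A x))) - g (S (A x)).
  have e : f (A x) (A (S (A x))) = (g (S (A x)))%:C%C.
    by rewrite (semi_innerC fP) AS fE; exact: conjc_real.
  have := g_ge0 (A x - A (S (A x))); rewrite {1}/g f_sub ?e //=; lra.
move=> x; rewrite !fE lecR leNgt; apply/negP => d0.
(* A positive first increment never shrinks, so [g] would grow linearly along the iterates of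
   [S \o A], while [N] stays at most [N x]. *)
have iter_step n : let y := iter n (S \o A) x in
    [/\ g (A x) - g x <= g (A y) - g y, n%:R * (g (A x) - g x) <= g y - g x & N y <= N x].
  elim: n => [|n [h1 h2 h3]]; first by split; rewrite //= mul0r subrr.
  rewrite iterS /=; move: (iter n _ x) h1 h2 h3 => y h1 h2 h3.
  have := step1 y; have := step2 y; have := NSA y; rewrite -natr1 mulrDl mul1r.
  by split; lra.
have dp : 0 < g (A x) - g x by rewrite subr_gt0.
have Nx : 0 <= N x by exact: le_trans (g_ge0 x) (fN x).
have [] := iter_step (Num.bound (N x / (g (A x) - g x))).
have : N x / (g (A x) - g x) < (Num.bound (N x / (g (A x) - g x)))%:R.
  by rewrite archi_boundP // divr_ge0 // ltW.
rewrite ltr_pdivrMr //; move: (iter _ _ x) => y h _ h1 h2.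
have h3 : g y <= N y by exact: fN.
have := g_ge0 x; lra.
Qed.

(** * Brehmer's condition in the three cases *)

Section BrehmerCases.
Variables (R : realType) (H : hilbert R) (k : nat) (T : 'I_k -> H -> H).
Variable q : 'I_k -> 'I_k -> R[i].
Hypothesis T_contr : forall i, contraction (T i).

Let T_lin i : linear (T i). Proof. by case: (T_contr i). Qed.

Lemma hnorm_sqr (x : H) : hnorm x ^+ 2 = rdot x x.
Proof. by rewrite sqr_sqrtr // rdot_ge0. Qed.

Lemma contraction_rdot i x : rdot (T i x) (T i x) <= rdot x x.
Proof.
by rewrite -!hnorm_sqr ler_pXn2r ?nnegrE ?sqrtr_ge0 //; case: (T_contr i).
Qed.

Lemma brehmer_isometry : (forall i, is_isometry (T i)) -> brehmer_positive T.
Proof.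
move=> T_isom; have br0 i s x y : brehmer T (i :: s) x y = 0.
  elim: s i x y => [|j s IH] i x y; first by rewrite /= T_isom subrr.
  by rewrite -[LHS]/(brehmer T (j :: s) x y - brehmer T (j :: s) (T i x) (T i y)) !IH subrr.
case=> [|i s] x _; last by rewrite br0.
exact: semi_inner_ge0 (hinner_semi_inner H) x.
Qed.

Lemma hnorm_le_opnorm i x : hnorm (T i x) <= opnorm (T i) * hnorm x.
Proof.
have hnormZ (a : R) (z : H) : 0 <= a -> hnorm (a%:C%C *: z) = a * hnorm z.
  move=> a0; rewrite -[a in RHS](ger0_norm a0) -sqrtr_sqr -sqrtrM ?sqr_ge0 //.
  congr Num.sqrt; rewrite -/(rdot _ _) rdotZl rdotZr; rewrite -/(rdot _ _); ring.
have [x0|xn0] := eqVneq (hnorm x) 0.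
  by rewrite x0 mulr0 -x0; case: (T_contr i).
have xp : 0 < hnorm x by rewrite lt_neqAle eq_sym xn0 sqrtr_ge0.
have xi : 0 <= (hnorm x)^-1 by rewrite invr_ge0 ltW.
rewrite -ler_pdivrMr // mulrC -hnormZ // -(linear_funZ (T_lin i)).
have y1 : hnorm ((hnorm x)^-1%:C%C *: x) <= 1 by rewrite hnormZ // mulVf.
(* The set under the supremum is bounded by 1 since [T i] is a contraction. *)
apply: ub_le_sup; last by exists ((hnorm x)^-1%:C%C *: x).
by exists 1 => _ [z z1 <-]; apply: le_trans z1; case: (T_contr i).
Qed.

Lemma brehmer_opnorm : \sum_(i < k) opnorm (T i) ^+ 2 <= 1 -> brehmer_positive T.
Proof.
move=> sumT.
(* Both bounds are needed at once: at [T i x] the lower one makes the subtracted term nonnegative,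
   the upper one bounds it by ||T_i||^2 |x|^2. *)
have bounds s x : uniq s ->
    (1 - \sum_(i <- s) opnorm (T i) ^+ 2)%:C%C * hinner x x <= brehmer T s x x <= hinner x x.
  elim: s x => [|i s IH] x; first by rewrite big_nil subr0 mul1r lexx.
  move=> /= /andP [_ us]; have /andP [l1 u1] := IH x us; have /andP [l2 u2] := IH (T i x) us.
  have s1 : \sum_(i <- s) opnorm (T i) ^+ 2 <= 1.
    apply: le_trans sumT; rewrite big_uniq //= [leRHS](bigID (mem s)) /= lerDl.
    by apply: sumr_ge0 => j _; exact: sqr_ge0.
  have b0 : 0 <= brehmer T s (T i x) (T i x).
    apply: le_trans l2; rewrite mulr_ge0 ?ler0c ?subr_ge0 //.
    exact: semi_inner_ge0 (hinner_semi_inner H) _.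
  have Tx : hinner (T i x) (T i x) <= (opnorm (T i) ^+ 2)%:C%C * hinner x x.
    rewrite !hinner_rdot -rmorphM lecR -!hnorm_sqr -exprMn.
    rewrite ler_pXn2r ?nnegrE ?sqrtr_ge0 ?hnorm_le_opnorm //.
    exact: le_trans (sqrtr_ge0 _) (hnorm_le_opnorm i x).
  apply/andP; split; last by rewrite lerBlDr (le_trans u1) // lerDl.
  rewrite big_cons opprD addrCA addrC rmorphD rmorphN mulrDl mulNr lerB //.
  exact: le_trans u2 Tx.
move=> s x us; have /andP [l _] := bounds s x us; apply: le_trans l.
rewrite mulr_ge0 ?(semi_inner_ge0 (hinner_semi_inner H)) // ler0c subr_ge0.
apply: le_trans sumT; rewrite big_uniq //= [leRHS](bigID (mem s)) /= lerDl.
by apply: sumr_ge0 => j _; exact: sqr_ge0.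
Qed.

Hypothesis q_norm : forall i j : 'I_k, (i < j)%N -> `|q i j| = 1.
Hypothesis T_comm : forall i j : 'I_k, (i < j)%N ->
  forall x, T i (T j x) = q i j *: T j (T i x).

Lemma brehmer_doubly_commuting :
  (forall i j : 'I_k, (i < j)%N -> forall S : H -> H, is_adjoint (T j) S ->
     forall x, T i (S x) = conjc (q i j) *: S (T i x)) ->
  brehmer_positive T.
Proof.
move=> dcomm; have hP := hinner_semi_inner H.
have [S hS] := choice (fun i => adjoint_exists (T_lin i) (contraction_rdot i)).
have hSr i x y : hinner (S i x) y = hinner x (T i y).
  by rewrite (semi_innerC hP) -hS -(semi_innerC hP).
(* The hypothesis covers [j < i]; for [i < j] the relation is the adjoint of the assumed one,
   checked in weak form. *)
have TS i j x : i != j -> T j (S i x) = (qext q j i)^* *: S i (T j x).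
  rewrite neq_ltn /qext => /orP [ij|ji]; last by rewrite ji; apply: dcomm.
  rewrite ltnNge (ltnW ij) /= ij.
  have qq : ((q i j)^-1)^* = q i j.
    rewrite fmorphV /=; have := normCK (q i j); rewrite q_norm // expr1n => e.
    have q0 : (q i j)^* != 0 by rewrite conjC_eq0 unimodular_neq0 ?q_norm.
    by apply: (mulIf q0); rewrite mulVf.
  rewrite qq; apply/eqP; rewrite -subr_eq0; apply/eqP/(@hinner_eq0 R H).
  move: {2}(_ - _) => z.
  rewrite (semi_innerDl hP) (semi_innerNl hP) (semi_innerZl hP).
  rewrite hS hSr (dcomm _ _ ij _ (hS j)) (semi_innerZr hP) conjCK.
  by rewrite hSr -hS subrr.
(* Exchanging [T j] with [T i] on the left and with [S i] on the right yields the same phase, as the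
   form is conjugate linear on the right. *)
have Sf u i x y : i \notin u -> brehmer T u (T i x) y = brehmer T u x (S i y).
  elim: u x y => [|j u IH] x y; first by rewrite /= hS.
  rewrite inE negb_or => /andP [ij iu] /=.
  rewrite (qext_comm q_norm T_comm j i) (brehmerZl T_lin) !IH // (TS i j) //.
  by rewrite (brehmerZr T_lin) conjCK.
(* The upper bound is carried along to supply the bounding function [N] of
   [semi_inner_contraction]. *)
suff main u x : uniq u -> 0 <= brehmer T u x x <= hinner x x.
  by move=> u x us; have /andP [] := main u x us.
elim: u x => [|i u IH] x; first by rewrite (semi_inner_ge0 hP) lexx.
move=> /= /andP [iu us].
have fP : semi_inner (brehmer T u).
  split; [exact: brehmerPl | exact: brehmerC | move=> y].
  by have /andP [] := IH y us.
have fN y : complex.Re (brehmer T u y y) <= rdot y y.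
  by have /andP [_] := IH y us; rewrite lecE => /andP [].
have NSA y : rdot (S i (T i y)) (S i (T i y)) <= rdot y y.
  apply: le_trans (contraction_rdot i y).
  exact: adjoint_contraction (contraction_rdot i) _ (hS i) _.
rewrite subr_ge0 lerBlDr.
rewrite (semi_inner_contraction fP (fun x y => Sf u i x y iu) fN NSA) /=.
have /andP [_ ux] := IH x us; apply: le_trans ux _.
by rewrite lerDl (semi_inner_ge0 fP).
Qed.

End BrehmerCases.

Theorem theorem4p7 (R : realType) (H : hilbert R) (k : nat)
    (T : 'I_k -> H -> H) (q : 'I_k -> 'I_k -> R[i])
    (hT : forall i, contraction (T i))
    (hq : forall i j : 'I_k, (i < j)%N -> `|q i j| = 1)
    (hcomm : forall i j : 'I_k, (i < j)%N -> forall x, T i (T j x) = q i j *: T j (T i x)) :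
  [/\ (forall i, is_isometry (T i)) -> regular_Q_unitary_dilation q T,
      (forall i j : 'I_k, (i < j)%N -> forall S : H -> H, is_adjoint (T j) S ->
          forall x, T i (S x) = conjc (q i j) *: S (T i x)) ->
        regular_Q_unitary_dilation q T
    & \sum_(i < k) opnorm (T i) ^+ 2 <= 1 -> regular_Q_unitary_dilation q T].
Proof.
have T_lin i : linear (T i) by case: (hT i).
split=> [T_isom|dcomm|sumT]; apply: brehmer_regular_dilation => //.
- exact: brehmer_isometry.
- exact: (brehmer_doubly_commuting hT hq hcomm).
- exact: (brehmer_opnorm hT).
Qed.
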